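(* Let $\mathbb F$ be $\mathbb R$ or $\mathbb C$. For $n\ge5$, the space $\mathfrak M_n^{\mathsf{Haus}}=\mathfrak M_n^{\mathsf{Haus}}(\mathbb F)$ is compact for $n$ odd, but not for $n$ even.
   Context: An effective divisor of degree $n$ on $\mathbb P^1=\mathbb P^1(\mathbb F)$ is a formal sum $\mathcal D=m_1\langle\mathbf p_1\rangle+\cdots+m_k\langle\mathbf p_k\rangle$ with distinct points $\mathbf p_j\in\mathbb P^1(\mathbb F)$, integer multiplicities $m_j\ge1$, and $\sum m_j=n$. The space $\widehat{\mathfrak D}_n$ of all such divisors is topologized by regarding a divisor as the root divisor of a homogeneous polynomial of degree $n$ in two variables up to a nonzero constant: $\widehat{\mathfrak D}_n(\mathbb C)\cong\mathbb P^n(\mathbb C)$, and $\widehat{\mathfrak D}_n(\mathbb R)$ is the closed subset of $\mathbb P^n(\mathbb R)$ of real polynomials with only real roots. $\mathbf G=\mathrm{PGL}_2(\mathbb F)$ acts on $\mathbb P^1$ and hence on $\widehat{\mathfrak D}_n$. $\widehat{\mathfrak D}_n^{\mathsf{fs}}$ is the open subset of divisors with finite stabilizer (equivalently with at least three distinct points), and $\mathfrak M_n=\widehat{\mathfrak D}_n^{\mathsf{fs}}/\mathbf G$ with the quotient topology. For $n>4$, $\mathfrak M_n^{\mathsf{Haus}}\subset\mathfrak M_n$ is the open subset consisting of $\mathbf G$-equivalence classes of divisors with $\max_j\{m_j\}<n/2$ (this subset is Hausdorff). *)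

(* Defs.v *)
From HB Require Import structures.
From mathcomp Require Import all_boot all_order all_algebra.
From mathcomp Require Import finmap multiset.
From mathcomp Require Import generic_quotient.
From mathcomp Require Import all_classical all_reals.
From mathcomp Require Import topology normedtype.
From mathcomp Require Import complex.
From mathcomp Require Import zify.

Set Implicit Arguments.
Unset Strict Implicit.
Unset Printing Implicit Defensive.

Import Order.TTheory GRing.Theory Num.Theory.
Import numFieldNormedType.Exports.

Local Open Scope quotient_scope.
Local Open Scope mset_scope.
Local Open Scope classical_set_scope.
Local Open Scope ring_scope.

(* Everything is defined over a numFieldType F with the topology of its norm,
   so that F can be a realType R or its complexification R[i]. *)

Section Scaling.
Variables (F : fieldType) (V : lmodType F) (A : set V).

Definition scaling (u v : A) : bool :=
  `[< exists2 c : F, c != 0 & set_val u = c *: set_val v >].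

Lemma scaling_refl : reflexive scaling.
Proof. by move=> u; apply/asboolP; exists 1; rewrite ?oner_neq0 ?scale1r. Qed.

Lemma scaling_imp_sym u v : scaling u v -> scaling v u.
Proof.
move=> /asboolP[c c0 e]; apply/asboolP; exists c^-1; first by rewrite invr_eq0.
by rewrite e scalerA mulVf // scale1r.
Qed.

Lemma scaling_sym : symmetric scaling.
Proof. by move=> u v; apply/idP/idP; exact: scaling_imp_sym. Qed.

Lemma scaling_trans : transitive scaling.
Proof.
move=> v u w /asboolP[c c0 e] /asboolP[d d0 e']; apply/asboolP; exists (c * d).
  by rewrite mulf_neq0.
by rewrite e e' scalerA.
Qed.

Canonical scaling_equiv :=
  EquivRel scaling scaling_refl scaling_sym scaling_trans.

End Scaling.

Section ProjectiveSpace.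
Variables (F : numFieldType) (n : nat).

Definition nonzero_vec : set 'rV[F]_n.+1 := [set v | v != 0].

Definition proj_space : Type :=
  quotient_topology {eq_quot (scaling_equiv nonzero_vec)}.

HB.instance Definition _ := Topological.on proj_space.
HB.instance Definition _ := Quotient.on proj_space.

Definition proj_pt (v : 'rV[F]_n.+1) (v0 : v != 0) : proj_space :=
  \pi_proj_space (SigSub (mem_set (v0 : nonzero_vec v))).

Definition proj_coord (p : proj_space) : 'rV[F]_n.+1 := set_val (repr p).

Lemma proj_coord_neq0 p : proj_coord p != 0.
Proof. exact: (set_valP (repr p)). Qed.

Lemma proj_ptP (u v : 'rV[F]_n.+1) (u0 : u != 0) (v0 : v != 0) :
  proj_pt u0 = proj_pt v0 <-> exists2 c, c != 0 & u = c *: v.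
Proof.
split=> [/eqquotP/asboolP // | e].
by apply/eqquotP/asboolP.
Qed.

Lemma proj_coordK p : proj_pt (proj_coord_neq0 p) = p.
Proof.
rewrite -[RHS]reprK; apply/eqquotP/asboolP.
by exists 1; rewrite ?oner_neq0 ?scale1r.
Qed.

End ProjectiveSpace.

Section PGL2.
Variable F : numFieldType.

Definition GL2 : set 'M[F]_2 := [set A | A \in unitmx].

Definition PGL2 : Type := {eq_quot (scaling_equiv GL2)}.

HB.instance Definition _ := Quotient.on PGL2.

Definition pgl (A : 'M[F]_2) (uA : A \in unitmx) : PGL2 :=
  \pi_PGL2 (SigSub (mem_set (uA : GL2 A))).

Definition pgl_mx (g : PGL2) : 'M[F]_2 := set_val (repr g).

Lemma pgl_mx_unit g : pgl_mx g \in unitmx.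
Proof. exact: (set_valP (repr g)). Qed.

Lemma pgl_mxK g : pgl (pgl_mx_unit g) = g.
Proof.
rewrite -[RHS]reprK; apply/eqquotP/asboolP.
by exists 1; rewrite ?oner_neq0 ?scale1r.
Qed.

Lemma pgl_mx_pgl A (uA : A \in unitmx) :
  exists2 c, c != 0 & pgl_mx (pgl uA) = c *: A.
Proof.
have /eqquotP/asboolP // : pgl (pgl_mx_unit (pgl uA)) = pgl uA.
exact: pgl_mxK.
Qed.

Lemma mulmx_neq0 (A : 'M[F]_2) (v : 'rV[F]_2) :
  A \in unitmx -> v != 0 -> v *m A^T != 0.
Proof.
move=> uA; apply: contra_neq => e.
by rewrite -(mulmxK (_ : A^T \in unitmx) v) ?unitmx_tr // e mul0mx.
Qed.

(* Points are row vectors, so the column A v is (v *m A^T). *)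
Definition pgl_act (g : PGL2) (p : proj_space F 1) : proj_space F 1 :=
  proj_pt (mulmx_neq0 (pgl_mx_unit g) (proj_coord_neq0 p)).

Lemma pgl_actE A (uA : A \in unitmx) (v : 'rV[F]_2) (v0 : v != 0) :
  pgl_act (pgl uA) (proj_pt v0) = proj_pt (mulmx_neq0 uA v0).
Proof.
apply/proj_ptP.
have [c c0 ->] := pgl_mx_pgl uA.
have [d d0 ->] : exists2 d, d != 0 & proj_coord (proj_pt v0) = d *: v.
  by apply/(proj_ptP (proj_coord_neq0 _) v0); exact: proj_coordK.
exists (c * d); first by rewrite mulf_neq0.
by rewrite linearZ /= -scalemxAr -scalemxAl scalerA.
Qed.

Lemma pgl_act1 p : pgl_act (pgl (unitmx1 _ _)) p = p.
Proof.
rewrite -{1}[p]proj_coordK pgl_actE -[RHS]proj_coordK; apply/proj_ptP.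
by exists 1; rewrite ?oner_neq0 // scale1r trmx1 mulmx1.
Qed.

Lemma pgl_actM A B (uA : A \in unitmx) (uB : B \in unitmx)
    (uAB : A *m B \in unitmx) p :
  pgl_act (pgl uA) (pgl_act (pgl uB) p) = pgl_act (pgl uAB) p.
Proof.
rewrite -[p]proj_coordK !pgl_actE; apply/proj_ptP.
by exists 1; rewrite ?oner_neq0 // scale1r trmx_mul mulmxA.
Qed.

End PGL2.

Section Divisors.
Variables (F : numFieldType) (n : nat).

Local Notation P1 := (proj_space F 1).

Definition mset_degree (D : {mset P1}) : nat := (\sum_(p <- finsupp D) D p)%N.

Definition divisor : Type := {D : {mset P1} | mset_degree D == n}.

HB.instance Definition _ := Choice.on divisor.

(* A form sum_i a_i x^i y^(n-i) of degree n is encoded by its coefficients a_i,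
   that is, by the polynomial sum_i a_i 'X^i of size at most n.+1 obtained by
   setting y = 1. The linear form with root (v_0 : v_1) is v_1 x - v_0 y; at the
   point (1 : 0) it is a multiple of y, which becomes a nonzero constant. *)
Definition root_form (p : P1) : {poly F} :=
  let v := proj_coord p in v 0 1 *: 'X - (v 0 0)%:P.

Definition divisor_form (D : {mset P1}) : {poly F} :=
  \prod_(p <- finsupp D) root_form p ^+ D p.

Lemma root_form_neq0 p : root_form p != 0.
Proof.
apply: contra_neq (proj_coord_neq0 p) => /polyP e.
apply/rowP => i; rewrite mxE.
have [i0 | i1] : i = 0 \/ i = 1.
  by case: i => -[|[|i]] // lti; [left | right]; apply: val_inj.
  have := e 0%N; rewrite coefB coefZ coefX coefC mulr0 sub0r coef0 => /eqP.
  by rewrite oppr_eq0 => /eqP; rewrite i0.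
have := e 1%N.
by rewrite coefB coefZ coefX coefC mulr1 subr0 coef0 i1.
Qed.

Lemma size_root_form p : (size (root_form p) <= 2)%N.
Proof.
rewrite (leq_trans (size_polyD _ _)) // geq_max size_polyN.
rewrite (leq_trans (size_scale_leq _ _)) ?size_polyX //=.
by rewrite (leq_trans (size_polyC_leq1 _)).
Qed.

Lemma divisor_form_neq0 D : divisor_form D != 0.
Proof.
by rewrite prodf_seq_neq0; apply/allP => p _; rewrite expf_neq0 ?root_form_neq0.
Qed.

Lemma size_divisor_form D : (size (divisor_form D) <= (mset_degree D).+1)%N.
Proof.
rewrite /divisor_form /mset_degree; elim/big_rec2: _ => [|p q k _ le_k].
  by rewrite size_poly1.
rewrite (leq_trans (size_polyMleq _ _)) //.
have : (size (root_form p ^+ D p) <= (D p).+1)%N.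
  rewrite (leq_trans (size_poly_exp_leq _ _)) // ltnS.
  by have := size_root_form p; nia.
move: le_k; lia.
Qed.

Lemma divisor_coef_neq0 (D : divisor) :
  poly_rV (divisor_form (val D)) != 0 :> 'rV[F]_n.+1.
Proof.
apply: contra_neq (divisor_form_neq0 (val D)) => e.
have /poly_rV_K <- : (size (divisor_form (val D)) <= n.+1)%N.
  by rewrite -[X in (_ <= X.+1)%N](eqP (valP D)) size_divisor_form.
by rewrite e linear0.
Qed.

Definition divisor_class (D : divisor) : proj_space F n :=
  proj_pt (divisor_coef_neq0 D).

(* Pullback of the topology of the projective space of forms: over R[i] the
   map divisor_class is onto, over R its image is the set of (classes of) forms
   with only real roots, with the subspace topology. *)
HB.instance Definition _ :=
  Topological.copy divisor (initial_topology divisor_class).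

Definition pgl_act_mset (g : PGL2 F) (D : {mset P1}) : {mset P1} :=
  seq_mset [seq pgl_act g p | p <- D].

Lemma pgl_act_msetP g (D : divisor) : mset_degree (pgl_act_mset g (val D)) == n.
Proof.
rewrite /mset_degree -size_mset (perm_size (perm_eq_seq_mset _)) size_map.
by rewrite size_mset; exact: (valP D).
Qed.

Definition pgl_act_div (g : PGL2 F) (D : divisor) : divisor :=
  Sub (pgl_act_mset g (val D)) (pgl_act_msetP g D).

Lemma pgl_act_div1 D : pgl_act_div (pgl (unitmx1 _ _)) D = D.
Proof.
apply: val_inj => /=; rewrite /pgl_act_mset.
by rewrite (eq_map (@pgl_act1 F)) map_id seq_mset_id.
Qed.

Lemma pgl_act_divM A B (uA : A \in unitmx) (uB : B \in unitmx)
    (uAB : A *m B \in unitmx) D :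
  pgl_act_div (pgl uA) (pgl_act_div (pgl uB) D) = pgl_act_div (pgl uAB) D.
Proof.
apply: val_inj => /=; apply/eq_seq_msetP.
rewrite (permPl (perm_map _ (perm_eq_seq_mset _))) -map_comp.
by rewrite (eq_map (pgl_actM uA uB uAB)).
Qed.

Definition stabilizer (D : divisor) : set (PGL2 F) :=
  [set g | pgl_act_div g D = D].

Definition fs_divisor : set divisor := [set D | finite_set (stabilizer D)].

Definition same_orbit (D E : fs_divisor) : bool :=
  `[< exists g, pgl_act_div g (set_val D) = set_val E >].

Lemma same_orbit_refl : reflexive same_orbit.
Proof.
move=> D; apply/asboolP.
by exists (pgl (unitmx1 _ _)); rewrite pgl_act_div1.
Qed.

Lemma same_orbit_imp_sym D E : same_orbit D E -> same_orbit E D.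
Proof.
move=> /asboolP[g e]; apply/asboolP; rewrite -e.
have uV : invmx (pgl_mx g) \in unitmx by rewrite unitmx_inv pgl_mx_unit.
have u1 : invmx (pgl_mx g) *m pgl_mx g \in unitmx.
  by rewrite unitmx_mul uV pgl_mx_unit.
exists (pgl uV); rewrite -[X in pgl_act_div X (set_val D)]pgl_mxK.
rewrite (pgl_act_divM _ _ u1); move: u1; rewrite mulVmx ?pgl_mx_unit // => u1.
by rewrite (bool_irrelevance u1 (unitmx1 _ _)) pgl_act_div1.
Qed.

Lemma same_orbit_sym : symmetric same_orbit.
Proof. by move=> D E; apply/idP/idP; exact: same_orbit_imp_sym. Qed.

Lemma same_orbit_trans : transitive same_orbit.
Proof.
move=> E D G /asboolP[g e] /asboolP[h e']; apply/asboolP; rewrite -e' -e.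
have uM : pgl_mx h *m pgl_mx g \in unitmx by rewrite unitmx_mul !pgl_mx_unit.
exists (pgl uM); rewrite -[X in _ = pgl_act_div _ (pgl_act_div X _)]pgl_mxK.
by rewrite -[X in _ = pgl_act_div X _]pgl_mxK (pgl_act_divM _ _ uM).
Qed.

Canonical orbit_equiv :=
  EquivRel same_orbit same_orbit_refl same_orbit_sym same_orbit_trans.

Definition moduli : Type := quotient_topology {eq_quot orbit_equiv}.

HB.instance Definition _ := Topological.on moduli.
HB.instance Definition _ := Quotient.on moduli.

Definition max_mult (D : divisor) : nat :=
  (\max_(p <- finsupp (val D)) val D p)%N.

(* The condition max_j m_j < n/2 is written without division. *)
Definition moduli_haus : set moduli :=
  [set \pi_moduli D | D in [set D : fs_divisor |
    (2 * max_mult (set_val D) < n)%N]].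

End Divisors.

Arguments moduli_haus F n : clear implicits.

(* Main.v *)
Require Import Defs.
From mathcomp Require Import all_boot all_order all_algebra.
From mathcomp Require Import finmap multiset generic_quotient.
From mathcomp Require Import all_classical all_reals.
From mathcomp Require Import topology normedtype.
From mathcomp Require Import complex.
From mathcomp Require Import zify ring.
Set Implicit Arguments.
Unset Strict Implicit.
Unset Printing Implicit Defensive.
Import numFieldNormedType.Exports.
Import Order.TTheory GRing.Theory Num.Theory.
Local Open Scope quotient_scope.
Local Open Scope mset_scope.
Local Open Scope classical_set_scope.
Local Open Scope ring_scope.

(** The argument is run over any numeric field whose closed unit ball is compact
    and in which powers of 2 are unbounded; both hold for R and R[i].  A divisor
    of degree n is represented by an n x 2 matrix whose rows are unit vectors
    (for the norm |v_0| + |v_1|) lifting its points.  The set of such matrices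
    is compact, and the coefficients of the form with prescribed roots are
    polynomials in the entries, so a compact set of matrices whose divisors have
    finite stabilizers has a compact image in the moduli space
    ([compact_orbit_classes]).

    Odd degree.  This is a coarse version of the Kempf-Ness argument.  Let f(A)
    be the product of the lengths of the vectors A v_i, for A in SL_2.  If every
    multiplicity is less than n / 2, then f is bounded below by a positive
    constant ([length_prod_lower_bound]): at most one point of the divisor can
    be contracted strongly by A, and then the others, more than half of the
    total, are expanded by the inverse factor, since A preserves determinants.
    Hence some A comes within a factor 2 of the infimum, and every class has a
    representative in the set K of unit tuples with 1 <= 2 f(B) for all B in
    SL_2 ([nearly_minimal_orbit]).  K is closed, hence compact.  Conversely a
    tuple of K has no point of multiplicity m > n / 2: a matrix of SL_2 that
    contracts this point by t multiplies f by about t^(n - 2m), which tends to 0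
    as t grows ([nearly_minimal_no_half]).  For n odd, m > n / 2 is the negation
    of m < n / 2, so the image of K is exactly the subspace in question.

    Even degree, n = 2k.  Call a tuple eta-pinched if for all i, j < k <= l, m
    the cross-ratio |v_i v_j| |v_l v_m| / (|v_i v_l| |v_j v_m|) is at most eta:
    an annulus of large modulus separates the first k points from the last k.
    This condition is closed and invariant under PGL_2, so it defines closed
    subsets of the moduli space ([closed_pinched_classes]), decreasing with eta;
    closedness uses that the multiples of the members of a compact set of forms
    make up a closed set, and that a form determines its roots
    ([divisor_class_inj]).  Each of these subsets contains the class of a
    divisor with n distinct points ([pinched_example]).  But a divisor that is
    eta-pinched, in some ordering, for a small enough eta has its first k points
    or its last k points all equal, so no class with all multiplicities below k
    lies in all of them ([no_pinched_class]).  This contradicts compactness. *)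

(** * Topological preliminaries *)

Lemma continuous_mx (T : topologicalType) (F : numFieldType) m n
    (f : T -> 'M[F]_(m, n)) :
  (forall i j, continuous (fun t => f t i j)) -> continuous f.
Proof.
move=> cf t U [P Pn PU].
have : \forall s \near t, forall i j, P i j (f s i j).
  apply: filter_forall => i; apply: filter_forall => j.
  exact: cf (Pn i j).
by apply: filterS => s; exact: PU.
Qed.

Lemma compact_mx (F : numFieldType) m n (A : set F) :
  compact A -> compact [set M : 'M[F]_(m, n) | forall i j, A (M i j)].
Proof.
move=> cA.
have cV : compact [set v : 'rV[F]_(m * n) | forall k, A (v ord0 k)].
  by apply: (@rV_compact F _ (fun=> A)).
have cf : continuous (vec_mx : 'rV[F]_(m * n) -> 'M[F]_(m, n)).
  apply: continuous_mx => i j; rewrite (_ : (fun t => _) =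
    (fun v : 'rV[F]_(m * n) => v ord0 (mxvec_index i j))).
    exact: coord_continuous.
  by apply/funext => v; rewrite mxE.
have := continuous_compact (continuous_subspaceT cf) cV.
congr compact; apply/seteqP; split=> [_ [v Av <-] i j|M AM].
  by rewrite mxE; exact: Av.
exists (mxvec M); last exact: mxvecK.
by move=> k; case/mxvec_indexP: k => i j; rewrite /= mxvecE; exact: AM.
Qed.

(** A point of the domain carries the proof that makes its image defined: this
    is how compactness is transported to a space of orbits that only exists for
    divisors with finite stabilizer. *)
Lemma compact_range_set_type (T U : topologicalType) (K : set T) (f : K -> U) :
  compact K -> continuous f -> compact (range f).
Proof.
move=> cK cf; have [[x Kx]|K0] := pselect (K !=set0); last first.
  rewrite (_ : range f = set0); first exact: compact0.
  rewrite -subset0 => _ [u _ <-]; apply: K0.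
  by exists (set_val u); exact: set_valP.
pose y := f (SigSub (mem_set Kx)).
have cV : {within K, continuous (valL_ y f)}.
  by have [_ H] := @subspace_valL_continuousP' T K U y f; exact: H.
have fE (u : K) : valL_ y f (set_val u) = f u.
  by have /(congr1 (fun g => g u)) := valLK y f.
have := continuous_compact cV cK.
congr compact; apply/seteqP; split=> [_ [t Kt <-]|_ [u _ <-]].
  by exists (SigSub (mem_set Kt)) => //; rewrite -fE.
by exists (set_val u); [exact: set_valP | exact: fE].
Qed.

(** The order of F may be partial, as for the complex numbers, but two real
    elements compare, and the elements near h t are within reach of h t < 0. *)
Lemma closed_nonneg (T : topologicalType) (F : numFieldType) (h : T -> F) :
  (forall t, h t \is Num.real) -> continuous h -> closed [set t | 0 <= h t].
Proof.
move=> hr ch; rewrite -[X in closed X]setCK; apply: open_closedC.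
rewrite openE => t /= /negP; rewrite -real_ltNge ?real0 // => ht.
have h0 : 0 < - h t by rewrite oppr_gt0.
have near_ht : \forall s \near t, ball (h t) (- h t) (h s).
  exact: ch (nbhsx_ballx (h t) _ h0).
rewrite /interior; near=> s; apply/negP.
have hst : `|h t - h s| < - h t by near: s.
rewrite -real_ltNge ?real0 //.
have : h s - h t < - h t.
  apply: le_lt_trans hst; rewrite distrC.
  by rewrite real_ler_norm // rpredB.
by rewrite -ltrBrDr subrr.
Unshelve. all: by end_near. Qed.

Lemma closed_le_norm (T : topologicalType) (F : numFieldType) (h k : T -> F) :
  continuous h -> continuous k -> closed [set t | `|h t| <= `|k t|].
Proof.
move=> ch ck.
have := @closed_nonneg T F (fun t => `|k t| - `|h t|).
have -> : [set t | 0 <= `|k t| - `|h t|] = [set t | `|h t| <= `|k t|].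
  by apply/seteqP; split=> t /=; rewrite subr_ge0.
apply; first by move=> t; rewrite rpredB ?normr_real.
by move=> t; apply: cvgB; apply: cvg_norm; [exact: ck | exact: ch].
Qed.

(** Projection along a compact factor is a closed map. *)
Lemma closed_exists_compact (T U : topologicalType) (K : set U)
    (R : set (T * U)) :
  compact K -> closed R -> closed [set t | exists2 u, K u & R (t, u)].
Proof.
move=> /compact_near_coveringP ncK cR.
rewrite -[X in closed X]setCK; apply: open_closedC.
rewrite openE => t /= tN.
have key u : K u -> \forall x \near u & s \near t, ~ R (s, x).
  move=> Ku; have : nbhs (t, u) (~` R).
    apply: open_nbhs_nbhs; split; first exact: closed_openC.
    by move=> Rtu; apply: tN; exists u.
  case=> -[P Q] /= [nP nQ] PQ.
  exists (Q, P) => //= -[u' s] /= [Qu Ps].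
  by apply: (PQ (s, u')).
have nK : \forall s \near t, K `<=` (fun u => ~ R (s, u)).
  exact: (ncK T (nbhs t) (fun s u => ~ R (s, u)) _ key).
rewrite /interior; near=> s; case=> u Ku; move: Ku.
have sK : K `<=` (fun u => ~ R (s, u)) by near: s.
exact: sK.
Unshelve. all: by end_near.
Qed.

Lemma continuous_mul (T : topologicalType) (F : numFieldType) (f g : T -> F) :
  continuous f -> continuous g -> continuous (fun t => f t * g t).
Proof. by move=> cf cg t; apply: cvgM; [exact: cf | exact: cg]. Qed.

Lemma continuous_sub (T : topologicalType) (F : numFieldType) (f g : T -> F) :
  continuous f -> continuous g -> continuous (fun t => f t - g t).
Proof. by move=> cf cg t; apply: cvgB; [exact: cf | exact: cg]. Qed.

Lemma continuous_sum_ord (T : topologicalType) (F : numFieldType) k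
    (f : 'I_k -> T -> F) :
  (forall i, continuous (f i)) -> continuous (fun t => \sum_i f i t).
Proof.
move=> cf t; elim: k f cf => [|k IH] f cf.
  by under eq_fun do rewrite big_ord0; exact: cvg_cst.
under eq_fun do rewrite big_ord_recl.
by apply: cvgD; [exact: cf | exact: IH].
Qed.

Lemma continuous_prod (T : topologicalType) (F : numFieldType) (I : Type)
    (r : seq I)
    (f : I -> T -> F) :
  (forall i, continuous (f i)) -> continuous (fun t => \prod_(i <- r) f i t).
Proof.
move=> cf; elim: r => [|i r IH].
  by under eq_fun do rewrite big_nil; exact: cst_continuous.
by under eq_fun do rewrite big_cons; exact: continuous_mul.
Qed.

Lemma closed_fiber (T : topologicalType) (F : numFieldType) (h : T -> F)
    (c : F) :
  continuous h -> closed [set t | h t = c].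
Proof.
move=> ch; rewrite (_ : [set _ | _] = [set t | `|h t - c| <= `|0 : F|]).
  apply: closed_le_norm; last exact: cst_continuous.
  by apply: continuous_sub => //; exact: cst_continuous.
apply/seteqP; split=> t /=; rewrite normr0 normr_le0 subr_eq0; first by move->.
by move/eqP.
Qed.

Lemma closed_quotient (T : topologicalType) (Q : quotType T)
    (C : set (quotient_topology Q)) :
  closed (\pi_(quotient_topology Q) @^-1` C) -> closed C.
Proof.
by move=> cC; rewrite -[C]setCK; apply: open_closedC; exact: closed_openC cC.
Qed.

Lemma closed_preimage (T U : topologicalType) (f : T -> U) (C : set U) :
  continuous f -> closed C -> closed (f @^-1` C).
Proof. by move=> cf cC; apply: closed_comp => // x _; exact: cf. Qed.

(** * Vectors of the plane, points of the projective line, divisors *)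

Section PlaneVectors.
Variable F : numFieldType.
Implicit Types (v w : 'rV[F]_2) (A : 'M[F]_2) (p : proj_space F 1).

Definition nrm v : F := `|v 0 0| + `|v 0 1|.
Definition det2 v w : F := v 0 0 * w 0 1 - v 0 1 * w 0 0.
Definition vec2 (a b : F) : 'rV[F]_2 := \row_j (if j == 0 then a else b).

Lemma sum_ord2 (V : nmodType) (f : 'I_2 -> V) : \sum_i f i = f 0 + f 1.
Proof. by rewrite big_ord_recl big_ord1; congr (_ + f _); apply: val_inj. Qed.

Lemma ord2P (P : 'I_2 -> Prop) : P 0 -> P 1 -> forall i, P i.
Proof.
move=> P0 P1 -[[|[|//]] lt2].
  by rewrite (_ : Ordinal _ = 0) //; apply: val_inj.
by rewrite (_ : Ordinal _ = 1) //; apply: val_inj.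
Qed.

Lemma vec2_eqP v w : v 0 0 = w 0 0 -> v 0 1 = w 0 1 -> v = w.
Proof. by move=> e0 e1; apply/rowP; apply: ord2P. Qed.

Lemma nrm_ge0 v : 0 <= nrm v. Proof. by rewrite addr_ge0. Qed.

Lemma nrm_eq0 v : (nrm v == 0) = (v == 0).
Proof.
apply/idP/eqP => [|->]; last by rewrite /nrm !mxE normr0 addr0.
rewrite paddr_eq0 // !normr_eq0 => /andP[/eqP v0 /eqP v1].
by apply: vec2_eqP; rewrite mxE.
Qed.

Lemma nrm_gt0 v : (0 < nrm v) = (v != 0).
Proof. by rewrite lt_def nrm_ge0 andbT nrm_eq0. Qed.

Lemma nrmZ c v : nrm (c *: v) = `|c| * nrm v.
Proof. by rewrite /nrm !mxE !normrM mulrDr. Qed.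

Lemma det2Zl c v w : det2 (c *: v) w = c * det2 v w.
Proof. by rewrite /det2 !mxE; ring. Qed.

Lemma det2Zr c v w : det2 v (c *: w) = c * det2 v w.
Proof. by rewrite /det2 !mxE; ring. Qed.

Lemma det_ord2 A : \det A = A 0 0 * A 1 1 - A 0 1 * A 1 0.
Proof.
rewrite (expand_det_row _ 0) sum_ord2 /cofactor !det_mx11 !mxE.
have -> : lift 0 0 = 1 :> 'I_2 by apply: val_inj.
have -> : lift 1 0 = 0 :> 'I_2 by apply: val_inj.
by rewrite /= expr0 expr1 mul1r mulN1r mulrN.
Qed.

Lemma det2_mulmx A v w : det2 (v *m A^T) (w *m A^T) = \det A * det2 v w.
Proof. by rewrite /det2 det_ord2 !mxE !sum_ord2 !mxE; ring. Qed.

(** The only link between lengths and determinants in the whole argument: two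
    vectors with a large determinant cannot both be short. *)
Lemma norm_det2_le v w : `|det2 v w| <= nrm v * nrm w.
Proof.
apply: le_trans (ler_normB _ _) _; rewrite !normrM /nrm mulrDl !mulrDr.
apply: lerD; first by rewrite lerDr mulr_ge0.
by rewrite lerDl mulr_ge0.
Qed.

Lemma det2_eq0P v w : v != 0 -> w != 0 ->
  det2 v w = 0 <-> exists2 c, c != 0 & v = c *: w.
Proof.
move=> v0 w0; split=> [|[c c0 ->]]; last by rewrite /det2 !mxE; ring.
rewrite /det2 => /eqP; rewrite subr_eq0 => /eqP e.
have [c vE] : exists c, v = c *: w.
  have [w00|w00] := eqVneq (w 0 0) 0.
    have w01 : w 0 1 != 0.
      by apply: contra_neq w0 => w01; apply: vec2_eqP; rewrite mxE.
    exists (v 0 1 / w 0 1); apply: vec2_eqP; rewrite mxE ?divfK //.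
    by apply: (mulIf w01); rewrite e w00 !mulr0 mul0r.
  exists (v 0 0 / w 0 0); apply: vec2_eqP; rewrite mxE ?divfK //.
  by rewrite mulrAC e mulfK.
exists c => //; apply: contra_neq v0 => c0.
by rewrite vE c0 scale0r.
Qed.

Lemma nonzero_or_one_neq0 v : (if v == 0 then const_mx 1 else v) != 0.
Proof.
case: ifP => [_|->//]; apply/eqP => /rowP /(_ 0); rewrite !mxE.
by apply/eqP; rewrite oner_eq0.
Qed.

(** The zero vector is sent to the point of (1 : 1), so that points can be taken
    of the rows of any matrix. *)
Definition pt v : proj_space F 1 := proj_pt (nonzero_or_one_neq0 v).

Lemma ptE v (v0 : v != 0) : pt v = proj_pt v0.
Proof.
by apply/proj_ptP; exists 1; rewrite ?oner_neq0 // scale1r (negPf v0).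
Qed.

Lemma pt_coord p : pt (proj_coord p) = p.
Proof. by rewrite (ptE (proj_coord_neq0 p)) proj_coordK. Qed.

Lemma pt_eqP v w : v != 0 -> w != 0 -> pt v = pt w <-> det2 v w = 0.
Proof.
by move=> v0 w0; rewrite (ptE v0) (ptE w0) proj_ptP det2_eq0P.
Qed.

Lemma pt_scale c v : c != 0 -> pt (c *: v) = pt v.
Proof.
move=> c0; have [->|v0] := eqVneq v 0; first by rewrite scaler0.
have cv0 : c *: v != 0 by rewrite scaler_eq0 negb_or c0.
by rewrite (ptE v0) (ptE cv0); apply/proj_ptP; exists c.
Qed.

Lemma proj_coord_pt v : v != 0 ->
  exists2 c, c != 0 & proj_coord (pt v) = c *: v.
Proof.
by move=> v0; apply/(proj_ptP (proj_coord_neq0 _) v0); rewrite proj_coordK ptE.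
Qed.

Lemma pgl_act_pt A (uA : A \in unitmx) v :
  v != 0 -> pgl_act (pgl uA) (pt v) = pt (v *m A^T).
Proof. by move=> v0; rewrite (ptE v0) (ptE (mulmx_neq0 uA v0)) pgl_actE. Qed.

Definition unit_coord p : 'rV[F]_2 := (nrm (proj_coord p))^-1 *: proj_coord p.

Lemma nrm_unit_coord p : nrm (unit_coord p) = 1.
Proof.
have p0 : nrm (proj_coord p) != 0 by rewrite nrm_eq0 proj_coord_neq0.
by rewrite nrmZ normfV (ger0_norm (nrm_ge0 _)) mulVf.
Qed.

Lemma nrm1_neq0 v : nrm v = 1 -> v != 0.
Proof. by rewrite -nrm_eq0 => ->; exact: oner_neq0. Qed.

Lemma pt_unit_coord p : pt (unit_coord p) = p.
Proof.
by rewrite pt_scale ?pt_coord // invr_eq0 nrm_eq0 proj_coord_neq0.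
Qed.

Lemma root_form_pt v : v != 0 ->
  exists2 c, c != 0 & root_form (pt v) = c *: (v 0 1 *: 'X - (v 0 0)%:P).
Proof.
move=> v0; have [c c0 e] := proj_coord_pt v0; exists c => //.
by rewrite /root_form e !mxE -!mul_polyC !polyCM mulrBr mulrA.
Qed.

End PlaneVectors.

Section DivisorsOfPoints.
Variables (F : numFieldType) (n : nat).
Local Notation P1 := (proj_space F 1).
Implicit Types (p q : 'I_n -> P1) (D : divisor F n).

Lemma degree_seq_mset (s : seq P1) : mset_degree (seq_mset s) = size s.
Proof. by rewrite /mset_degree -size_mset (perm_size (perm_eq_seq_mset _)). Qed.

Lemma div_of_subproof p : mset_degree (seq_mset (codom p)) == n.
Proof. by rewrite degree_seq_mset size_codom card_ord. Qed.

Definition div_of p : divisor F n :=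
  Sub (seq_mset (codom p)) (div_of_subproof p).

(** Divisors are handled through orderings p of their points, in which a point
    of multiplicity m is repeated m times. *)
Lemma divisorP D : exists p, D = div_of p.
Proof.
have szD : size (val D) == n by rewrite size_mset; exact: (valP D).
exists (tnth (Tuple szD)); apply: val_inj => /=.
have -> : codom (tnth (Tuple szD)) = val D.
  by rewrite codomE map_tnth_enum.
by rewrite seq_mset_id.
Qed.

Lemma div_of_mult p (x : P1) : val (div_of p) x = #|[pred i | p i == x]|.
Proof.
rewrite /= mset_seqE codomE count_map -sum1_card -sum1_count big_enum_cond.
by apply: eq_bigl => i; rewrite inE.
Qed.

Lemma max_mult_div_of p c : (0 < c)%N ->
  (max_mult (div_of p) < c)%N <-> forall x, (#|[pred i | p i == x]| < c)%N.
Proof.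
move=> c0; split=> [lt_c x|lt_c].
  rewrite -div_of_mult; apply: leq_ltn_trans lt_c.
  have [xD|] := boolP (x \in finsupp (val (div_of p))).
    by rewrite /max_mult; apply: leq_bigmax_seq.
  by move/fsfun_dflt ->.
rewrite -[c]prednK // ltnS; apply/bigmax_leqP_seq => x _ _.
by rewrite -ltnS prednK // div_of_mult.
Qed.

Lemma divisor_form_div_of p :
  divisor_form (val (div_of p)) = \prod_i root_form (p i).
Proof.
transitivity (\prod_(x <- val (div_of p)) root_form x).
  by rewrite big_mset.
rewrite (perm_big _ (perm_eq_seq_mset _)) /=.
by rewrite codomE big_map big_enum.
Qed.

Lemma pgl_act_div_of g p : pgl_act_div g (div_of p) = div_of (pgl_act g \o p).
Proof.
apply: val_inj => /=; apply/eq_seq_msetP.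
rewrite (permPl (perm_map _ (perm_eq_seq_mset _))) !codomE -map_comp.
exact: perm_refl.
Qed.

Lemma eq_div_ofP p q : div_of p = div_of q <-> perm_eq (codom p) (codom q).
Proof.
split=> [/(congr1 val) /= /eq_seq_msetP //|/eq_seq_msetP e].
exact: val_inj.
Qed.

End DivisorsOfPoints.

(** * A form is determined by its roots *)

Section RootsDetermineForm.
Variable F : numFieldType.
Local Notation P1 := (proj_space F 1).
Implicit Types (x y : P1) (s t : seq P1).

Lemma proj_coord_eqP x y : x = y <-> det2 (proj_coord x) (proj_coord y) = 0.
Proof.
by rewrite -pt_eqP ?proj_coord_neq0 // !pt_coord.
Qed.

Lemma size_prod_root_form s :
  (size (\prod_(x <- s) root_form x)%R <= (size s).+1)%N.
Proof.
elim: s => [|x s IH]; first by rewrite big_nil size_poly1.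
rewrite big_cons /=; apply: leq_trans (size_polyMleq _ _) _.
move: IH (size_root_form x); move: (size _) (size (root_form x)) => a b.
by lia.
Qed.

(** The coefficient in degree [size s] vanishes exactly when the point at
    infinity (1 : 0) is a root of the homogeneous form. *)
Lemma coef_prod_root_form s :
  (\prod_(x <- s) root_form x)`_(size s) = \prod_(x <- s) proj_coord x 0 1.
Proof.
elim: s => [|x s IH]; first by rewrite !big_nil coef1.
rewrite !big_cons /= -IH {1}/root_form mulrBl coefB -scalerAl coefZ coefXM.
rewrite coefCM [X in _ - _ * X]nth_default ?mulr0 ?subr0 //.
exact: size_prod_root_form.
Qed.

(** A root x = (v_0 : v_1) at finite distance is detected by evaluation at
    v_0 / v_1, and the point at infinity by the top coefficient. *)
Lemma mem_root_form s t x (c : F) : c != 0 -> size s = size t ->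
  \prod_(y <- s) root_form y = c *: \prod_(y <- t) root_form y ->
  x \in s -> x \in t.
Proof.
move=> c0 st e xs; set v := proj_coord x.
suff [y yt /eqP/proj_coord_eqP -> //] :
  exists2 y, y \in t & det2 (proj_coord x) (proj_coord y) == 0.
have [v1|v1] := eqVneq (v 0 1) 0.
  have : \prod_(y <- t) proj_coord y 0 1 == 0.
    have /eqP := congr1 (fun q : {poly F} => q`_(size s)) e.
    rewrite coefZ {2}st !coef_prod_root_form (big_rem x) //= -/v v1 mul0r.
    by rewrite eq_sym mulf_eq0 (negPf c0).
  rewrite prodf_seq_eq0 => /hasP[y yt /= /eqP y1]; exists y => //.
  by rewrite /det2 -/v y1 v1 mulr0 mul0r subrr.
have : (\prod_(y <- t) root_form y).[v 0 0 / v 0 1] == 0.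
  have /eqP := congr1 (fun q : {poly F} => q.[v 0 0 / v 0 1]) e.
  have xr : (root_form x).[v 0 0 / v 0 1] = 0.
    by rewrite /root_form !hornerE -/v /=; field.
  rewrite hornerZ (big_rem x) //= hornerM xr mul0r eq_sym mulf_eq0.
  by rewrite (negPf c0).
rewrite horner_prod prodf_seq_eq0 => /hasP[y yt /=].
rewrite /root_form !hornerE /= => /eqP ye; exists y => //; apply/eqP.
transitivity (v 0 1 * (proj_coord y 0 1 * v 0 0 / v 0 1 - proj_coord y 0 0)).
  by rewrite /det2 -/v; field.
by rewrite ye mulr0.
Qed.

Lemma prod_root_form_inj s t (c : F) : c != 0 -> size s = size t ->
  \prod_(x <- s) root_form x = c *: \prod_(x <- t) root_form x -> perm_eq s t.
Proof.
move=> c0; elim: s t => [|x s IH] t; first by move/esym/size0nil ->.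
move=> st e.
have xt : x \in t by apply: (mem_root_form c0 st e); rewrite mem_head.
rewrite perm_sym (perm_trans (perm_to_rem xt)) // perm_cons perm_sym.
apply: IH; first by rewrite size_rem // -st.
move: e; rewrite big_cons (perm_big _ (perm_to_rem xt)) /= big_cons.
by rewrite scalerAr => /(mulfI (root_form_neq0 x)).
Qed.

Lemma divisor_class_inj n : injective (@divisor_class F n).
Proof.
move=> D E; have [p ->] := divisorP D; have [q ->] := divisorP E.
move/proj_ptP => [c c0 e]; apply/eq_div_ofP.
have szP r : (size (divisor_form (val (@div_of F n r))) <= n.+1)%N.
  by rewrite -[X in (_ <= X.+1)%N](eqP (valP (div_of r))) size_divisor_form.
have formE r :
    \prod_(x <- codom r) root_form x = divisor_form (val (@div_of F n r)).
  by rewrite divisor_form_div_of codomE big_map big_enum.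
apply: (prod_root_form_inj c0); first by rewrite !size_codom.
rewrite !formE.
by rewrite -(poly_rV_K (szP p)) e linearZ /= poly_rV_K ?szP.
Qed.

End RootsDetermineForm.

Section FiniteStabilizers.
Variables (F : numFieldType) (n : nat).
Local Notation P1 := (proj_space F 1).

(** Cramer's rule with the denominator cleared. *)
Lemma cramer2 (u v w : 'rV[F]_2) :
  det2 u v *: w = det2 w v *: u + det2 u w *: v.
Proof. by apply: vec2_eqP; rewrite /det2 !mxE; ring. Qed.

Lemma mulmx_inj2 m (u v : 'rV[F]_2) (M : 'M[F]_(2, m)) :
  det2 u v != 0 -> u *m M = 0 -> v *m M = 0 -> M = 0.
Proof.
move=> d0 uM vM; apply/row_matrixP => i; rewrite row0 rowE.
apply: (scalerI d0); rewrite scaler0 scalemxAl cramer2 mulmxDl -!scalemxAl.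
by rewrite uM vM !scaler0 addr0.
Qed.

(** On lifts u, v, w of the three points, A u = a B u, A v = b B v and
    A w = c B w.  As w is a combination of u and v with nonzero coefficients,
    a = c = b, hence A = c B. *)
Lemma pgl_act_inj3 (g h : PGL2 F) (x y z : P1) :
  x != y -> y != z -> x != z ->
  pgl_act g x = pgl_act h x -> pgl_act g y = pgl_act h y ->
  pgl_act g z = pgl_act h z -> g = h.
Proof.
have ne (x' y' : P1) : x' != y' -> det2 (proj_coord x') (proj_coord y') != 0.
  by apply: contra_neq => /proj_coord_eqP.
move=> /ne; set u := proj_coord x; set v := proj_coord y => uv.
move=> /ne; rewrite -/v; set w := proj_coord z => vw.
move=> /ne; rewrite -/u -/w => uw.
have par x' : pgl_act g x' = pgl_act h x' -> exists2 c, c != 0 &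
    proj_coord x' *m (pgl_mx g)^T = c *: (proj_coord x' *m (pgl_mx h)^T).
  by move/proj_ptP.
move=> /par; rewrite -/u => -[a a0 ea].
move=> /par; rewrite -/v => -[b b0 eb].
move=> /par; rewrite -/w => -[c c0 ec].
set A := pgl_mx g in ea eb ec *; set B := pgl_mx h in ea eb ec *.
have BD : \det B != 0 by have := pgl_mx_unit h; rewrite unitmxE unitfE.
have wv : det2 w v != 0.
  by apply: contra_neq vw => e; rewrite -[RHS]oppr0 -e /det2; ring.
have uvB : det2 (u *m B^T) (v *m B^T) != 0 by rewrite det2_mulmx mulf_neq0.
(* Apply A to Cramer's rule for w, and subtract c B applied to it. *)
have lin : (det2 w v * (a - c)) *: (u *m B^T) +
           (det2 u w * (b - c)) *: (v *m B^T) = 0.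
  have /(congr1 (fun t => t *m A^T)) := cramer2 u v w.
  rewrite mulmxDl -!scalemxAl ea eb ec => eA.
  have /(congr1 (fun t => c *: (t *m B^T))) := cramer2 u v w.
  rewrite mulmxDl -!scalemxAl => eB.
  move: (u *m B^T) (v *m B^T) (w *m B^T) eA eB => U V W eA eB.
  apply/rowP => k; have := congr1 (fun t : 'rV[F]_2 => t 0 k) eA.
  have := congr1 (fun t : 'rV[F]_2 => t 0 k) eB; rewrite !mxE => eBk eAk.
  transitivity ((det2 w v * (a * U 0 k) + det2 u w * (b * V 0 k)) -
    c * (det2 w v * U 0 k + det2 u w * V 0 k)); first by ring.
  by rewrite -eAk -eBk; ring.
have uvB' : det2 (v *m B^T) (u *m B^T) != 0.
  by apply: contra_neq uvB => e; rewrite -[RHS]oppr0 -e /det2; ring.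
have det2Dl r s t : det2 (r + s) t = det2 r t + det2 s t :> F.
  by rewrite /det2 !mxE; ring.
have det2r0 (r : 'rV[F]_2) : det2 r r = 0 by rewrite /det2; ring.
have det20 (r : 'rV[F]_2) : det2 0 r = 0 by rewrite /det2 !mxE; ring.
have ac : a = c.
  have /eqP := congr1 (fun t => det2 t (v *m B^T)) lin.
  rewrite det20 det2Dl !det2Zl det2r0 mulr0 addr0 !mulf_eq0 (negPf wv).
  by rewrite (negPf uvB) orbF subr_eq0 => /eqP.
have bc : b = c.
  have /eqP := congr1 (fun t => det2 t (u *m B^T)) lin.
  rewrite det20 det2Dl !det2Zl det2r0 mulr0 add0r !mulf_eq0 (negPf uw).
  by rewrite (negPf uvB') orbF subr_eq0 => /eqP.
rewrite -[g]pgl_mxK -[h]pgl_mxK; apply/eqquotP/asboolP; exists c => //.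
apply/eqP; rewrite -subr_eq0 -(inj_eq trmx_inj) trmx0 linearB linearZ /=.
apply/eqP; apply: (mulmx_inj2 uv); rewrite mulmxBr -scalemxAr.
  by rewrite ea ac subrr.
by rewrite eb bc subrr.
Qed.

(** An element of the stabilizer is determined by the images of three of the
    points, and these belong to a finite set. *)
Lemma fs_divisor3 (p : 'I_n -> P1) i j k :
  p i != p j -> p j != p k -> p i != p k -> fs_divisor (div_of p).
Proof.
move=> ij jk ik; pose B : set P1 := [set` codom p].
pose f (g : PGL2 F) := (pgl_act g (p i), pgl_act g (p j), pgl_act g (p k)).
have finB : finite_set B by exact: finite_seq.
apply: (@sub_finite_set _ _ (f @^-1` (B `*` B `*` B))).
  move=> g /=; rewrite /stabilizer /= pgl_act_div_of => /eq_div_ofP e.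
  have gB l : B (pgl_act g (p l)).
    rewrite /B /= -(perm_mem e); exact: (codom_f (pgl_act g \o p)).
  by split; [split|].
apply: finite_preimage; last by do !apply: finite_setX.
by move=> g h _ _ [ei ej ek]; exact: (pgl_act_inj3 ij jk ik).
Qed.

Definition no_half (p : 'I_n -> P1) :=
  forall x, (2 * #|[pred i | p i == x]| < n)%N.

Lemma max_mult_no_half p : (2 * max_mult (div_of p) < n)%N <-> no_half p.
Proof.
have [n0|n0] := posnP n.
  by split=> [|/(_ (pt 0))]; rewrite [X in (_ < X)%N]n0.
have half m : (2 * m < n)%N = (m < uphalf n)%N by lia.
rewrite half max_mult_div_of; last by lia.
by split=> h x; have := h x; rewrite half.
Qed.

(** Two points cannot exhaust a divisor in which each has less than half of the
    degree, so there are three distinct ones. *)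
Lemma no_half_fs p : (0 < n)%N -> no_half p -> fs_divisor (div_of p).
Proof.
move=> n0 hp; pose i := Ordinal n0.
have ex (P : pred 'I_n) : (#|P| < n)%N -> exists j, ~~ P j.
  move=> Pn; apply/existsP; rewrite -negb_forall.
  apply: contraL Pn => /forallP PT; rewrite -leqNgt -[X in (X <= _)%N]card_ord.
  by apply/subset_leq_card/fintype.subsetP => l _; exact: PT.
have [j pj] : exists j, p j != p i.
  apply: (ex [pred j | p j == p i]); apply: leq_ltn_trans (hp (p i)).
  by rewrite mul2n -addnn leq_addr.
have [k] : exists k, ~~ [predU [pred k | p k == p i] & [pred k | p k == p j]] k.
  apply: ex; apply: (@leq_ltn_trans (#|[pred k | p k == p i]| +
    #|[pred k | p k == p j]|)%N); first by rewrite -cardUI leq_addr.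
  have add_lt a b : (2 * a < n -> 2 * b < n -> a + b < n)%N by lia.
  exact: add_lt (hp (p i)) (hp (p j)).
rewrite /= negb_or => /andP[ki kj].
rewrite inE /= in ki; rewrite inE /= in kj.
rewrite eq_sym in pj; rewrite eq_sym in ki; rewrite eq_sym in kj.
exact: fs_divisor3 pj kj ki.
Qed.

End FiniteStabilizers.

(** * Moduli classes of tuples of vectors *)

Section CoefficientMap.
Variables (F : numFieldType) (n : nat).
Local Notation P1 := (proj_space F 1).
Implicit Types (M : 'M[F]_(n, 2)).

Lemma continuous_coef_prod (T : topologicalType) (I : Type) (s : seq I)
    (f : I -> T -> {poly F}) :
  (forall i k, continuous (fun t => (f i t)`_k)) ->
  forall k, continuous (fun t => (\prod_(i <- s) f i t)`_k).
Proof.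
move=> cf; elim: s => [|i s IH] k.
  by under eq_fun do rewrite big_nil; move=> t; exact: cvg_cst.
under eq_fun do rewrite big_cons coefM.
by apply: continuous_sum_ord => j t; apply: cvgM; [exact: cf | exact: IH].
Qed.

Definition pts M (i : 'I_n) : P1 := pt (row i M).

Definition nonzero_rows : set 'M[F]_(n, 2) := [set M | forall i, row i M != 0].

Definition coef_vec M : 'rV[F]_n.+1 :=
  poly_rV (\prod_i (M i 1 *: 'X - (M i 0)%:P)).

Lemma continuous_coef_vec : continuous coef_vec.
Proof.
apply: continuous_mx => i j; rewrite /coef_vec.
under eq_fun do rewrite mxE.
apply: continuous_coef_prod => l k.
under eq_fun do rewrite coefB coefZ coefC.
apply: continuous_sub.
  by apply: continuous_mul; [exact: coord_continuous | exact: cst_continuous].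
by case: (k == 0%N); [exact: coord_continuous | exact: cst_continuous].
Qed.

Lemma divisor_form_pts M : nonzero_rows M ->
  exists2 c, c != 0 &
    poly_rV (divisor_form (val (div_of (pts M)))) = c *: coef_vec M.
Proof.
move=> M0; have /all_sig2[c c0 ce] i := cid2 (root_form_pt (M0 i)).
exists (\prod_i c i).
  by rewrite prodf_seq_neq0; apply/allP => i _; exact: c0.
rewrite /coef_vec -linearZ /= divisor_form_div_of; congr poly_rV.
under eq_bigr do rewrite ce !mxE -mul_polyC.
by rewrite big_split /= -rmorph_prod mul_polyC.
Qed.

Lemma coef_vec_neq0 M : nonzero_rows M -> coef_vec M != 0.
Proof.
move=> /divisor_form_pts[c c0 e]; have := divisor_coef_neq0 (div_of (pts M)).
by rewrite e; apply: contraNneq => ->; rewrite scaler0.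
Qed.

Lemma divisor_class_pts M (M0 : nonzero_rows M) :
  divisor_class (div_of (pts M)) = proj_pt (coef_vec_neq0 M0).
Proof. by apply/proj_ptP; exact: divisor_form_pts. Qed.

End CoefficientMap.

(** Proportionality as vanishing of the 2 x 2 minors, which is a closed
    condition. *)
Lemma proportionalP (F : numFieldType) m (x y : 'rV[F]_m) : x != 0 -> y != 0 ->
  (forall i j, x 0 i * y 0 j - x 0 j * y 0 i = 0) <->
  (exists2 c, c != 0 & x = c *: y).
Proof.
move=> x0 y0; split=> [h|[c c0 ->] i j]; last by rewrite !mxE; ring.
have [j yj] : exists j, y 0 j != 0.
  apply/existsP; rewrite -negb_forall; apply: contra_neqN y0 => /forallP y0.
  by apply/rowP => j; rewrite mxE; apply/eqP.
have xE : x = (x 0 j / y 0 j) *: y.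
  apply/rowP => i; rewrite mxE mulrAC; apply: (mulIf yj); rewrite divfK //.
  by apply/eqP; rewrite -subr_eq0 h.
exists (x 0 j / y 0 j) => //; apply: contra_neq x0 => c0.
by rewrite xE c0 scale0r.
Qed.

Section ModuliTopology.
Variables (F : numFieldType) (n : nat).
Implicit Types (M : 'M[F]_(n, 2)).

Definition orbit_class (D : divisor F n) (hD : fs_divisor D) : moduli F n :=
  \pi_(moduli F n) (SigSub (mem_set hD)).

(** All topologies on the way are initial or quotient topologies, so continuity
    reduces to that of the coefficients. *)
Lemma compact_orbit_classes (K : set 'M[F]_(n, 2))
    (K0 : K `<=` @nonzero_rows F n)
    (Kfs : forall M, K M -> fs_divisor (div_of (pts M))) :
  compact K -> compact (range (fun u : K => orbit_class (Kfs _ (set_valP u)))).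
Proof.
move=> cK; apply: compact_range_set_type => //.
pose s (u : K) : @fs_divisor F n := SigSub (mem_set (Kfs _ (set_valP u))).
have cs : continuous s.
  apply: continuous_comp_initial; apply: continuous_comp_initial.
  pose c (u : K) : @nonzero_vec F n :=
    SigSub (mem_set (coef_vec_neq0 (K0 _ (set_valP u)) : nonzero_vec _)).
  have cc : continuous c.
    apply: continuous_comp_initial => u.
    apply: (@continuous_comp _ _ _ set_val (@coef_vec F n)).
      exact: initial_continuous.
    exact: continuous_coef_vec.
  rewrite (_ : _ \o _ = \pi_(proj_space F n) \o c).
    by move=> u; apply: continuous_comp; [exact: cc | exact: pi_continuous].
  apply/funext => u /=; exact: (divisor_class_pts (K0 _ (set_valP u))).
move=> u; apply: (@continuous_comp _ _ _ s \pi_(moduli F n)); first exact: cs.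
exact: pi_continuous.
Qed.

(** Saturation makes the preimage of the set of classes the set of divisors
    coming from K.  By injectivity of [divisor_class] these are the divisors
    whose form is proportional to the form of some member of K; this condition
    is closed because K is compact. *)
Lemma closed_orbit_classes (K : set 'M[F]_(n, 2)) :
  K `<=` @nonzero_rows F n -> compact K ->
  (forall D E : @fs_divisor F n, same_orbit D E ->
    (exists2 M, K M & set_val D = div_of (pts M)) ->
    (exists2 M, K M & set_val E = div_of (pts M))) ->
  closed [set q : moduli F n |
    exists2 D : @fs_divisor F n, q = \pi_(moduli F n) D &
    exists2 M, K M & set_val D = div_of (pts M)].
Proof.
move=> K0 cK sat.
pose R : set ('rV[F]_n.+1 * 'M[F]_(n, 2)) :=
  [set t : 'rV[F]_n.+1 * 'M[F]_(n, 2) | forall i j,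
  t.1 0 i * coef_vec t.2 0 j - t.1 0 j * coef_vec t.2 0 i = 0].
have c1 i : continuous (fun t : 'rV[F]_n.+1 * 'M[F]_(n, 2) => t.1 0 i).
  move=> t; apply: (@continuous_comp _ _ _ fst (fun x : 'rV[F]_n.+1 => x 0 i)).
    exact: cvg_fst.
  exact: coord_continuous.
have c2 i :
    continuous (fun t : 'rV[F]_n.+1 * 'M[F]_(n, 2) => coef_vec t.2 0 i).
  move=> t; apply: (@continuous_comp _ _ _ snd (fun M => coef_vec M 0 i)).
    exact: cvg_snd.
  apply: (@continuous_comp _ _ _ _ (fun x : 'rV[F]_n.+1 => x 0 i)).
    exact: continuous_coef_vec.
  exact: coord_continuous.
have cR : closed R.
  rewrite (_ : R = \bigcap_i \bigcap_j [set t : 'rV[F]_n.+1 * 'M[F]_(n, 2) |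
      `|t.1 0 i * coef_vec t.2 0 j - t.1 0 j * coef_vec t.2 0 i| <= `|0 : F| ]).
    apply: closed_bigI => i _; apply: closed_bigI => j _.
    apply: closed_le_norm; last exact: cst_continuous.
    by apply: continuous_sub; apply: continuous_mul.
  apply/seteqP; split=> t Rt; first by move=> i _ j _ /=; rewrite Rt.
  by move=> i j; have := Rt i I j I; rewrite /= normr0 normr_le0 => /eqP.
have RZ c x M : c != 0 -> R (c *: x, M) <-> R (x, M).
  move=> c0; split=> h i j; have := h i j; rewrite /= !mxE -!mulrA -mulrBr.
    by move/eqP; rewrite mulf_eq0 (negPf c0) => /eqP.
  by move=> ->; rewrite mulr0.
pose Y : set (proj_space F n) :=
  [set q | exists2 M, K M & R (proj_coord q, M)].
have cY : closed Y.
  apply: closed_quotient.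
  rewrite (_ : _ @^-1` _ = set_val @^-1` [set x | exists2 M, K M & R (x, M)]).
    apply: closed_preimage; first exact: initial_continuous.
    exact: closed_exists_compact.
  have pE (u : @nonzero_vec F n) : exists2 c, c != 0 &
      proj_coord (\pi_(proj_space F n) u) = c *: set_val u.
    by have /eqquotP/asboolP := reprK (\pi_(proj_space F n) u).
  apply/seteqP; split=> u [M KM RuM]; exists M => //.
    by have [c c0 uE] := pE u; move: RuM; rewrite uE RZ.
  by have [c c0 uE] := pE u; rewrite uE RZ.
apply: closed_quotient.
rewrite (_ : _ @^-1` _ = (@divisor_class F n \o set_val) @^-1` Y).
  apply: closed_preimage => // D.
  apply: (@continuous_comp _ _ _ set_val (@divisor_class F n)).
    exact: initial_continuous.
  exact: initial_continuous.
have RP (q : proj_space F n) M (M0 : nonzero_rows M) :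
    R (proj_coord q, M) <-> q = proj_pt (coef_vec_neq0 M0).
  rewrite -[q in X in _ <-> X]proj_coordK proj_ptP.
  exact: proportionalP (proj_coord_neq0 q) (coef_vec_neq0 M0).
apply/seteqP; split=> D /=.
  move=> [E DE hE].
  have ED : same_orbit E D by move: DE => /esym/eqquotP.
  have [M KM DM] := sat _ _ ED hE; exists M => //.
  apply: (iffRL (RP _ M (K0 _ KM))).
  by rewrite -divisor_class_pts -DM.
move=> [M KM /(RP _ _ (K0 _ KM))]; rewrite -divisor_class_pts.
by move/divisor_class_inj => DM; exists D => //; exists M.
Qed.

End ModuliTopology.

(** * Odd degree *)

Section NormBounds.
Variables (F : numFieldType) (n : nat).
Implicit Types (M : 'M[F]_(n, 2)) (A B : 'M[F]_2).

(** The inverse of 1 plus the sum of the inverses is below all the values; this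
    bound makes sense even in a partially ordered field. *)
Lemma finite_pos_lower_bound (I : finType) (f : I -> F) :
  (forall i, 0 < f i) -> exists d, [/\ 0 < d, d <= 1 & forall i, d <= f i].
Proof.
move=> f0; set s := 1 + \sum_i (f i)^-1.
have sum0 : 0 <= \sum_i (f i)^-1.
  by apply: sumr_ge0 => i _; rewrite invr_ge0 ltW.
have s1 : 1 <= s by rewrite lerDl.
have s0 : 0 < s by exact: lt_le_trans s1.
exists s^-1; split; rewrite ?invr_gt0 ?invf_le1 // => i.
rewrite -[leRHS]invrK lef_pV2 ?posrE ?invr_gt0 //.
rewrite /s (bigD1 i) //= addrCA lerDl addr_ge0 //.
by apply: sumr_ge0 => j _; rewrite invr_ge0 ltW.
Qed.

Definition unit_rows : set 'M[F]_(n, 2) :=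
  [set M | forall i, nrm (row i M) = 1].

Lemma unit_rows_nonzero M : unit_rows M -> nonzero_rows M.
Proof. by move=> M1 i; apply: nrm1_neq0. Qed.

Lemma det_gap M : exists d : F, [/\ 0 < d, d <= 1 & forall i j,
  det2 (row i M) (row j M) != 0 -> d <= `|det2 (row i M) (row j M)|].
Proof.
pose f (ij : 'I_n * 'I_n) : F :=
  if det2 (row ij.1 M) (row ij.2 M) == 0 then 1
  else `|det2 (row ij.1 M) (row ij.2 M)|.
have f0 ij : 0 < f ij by rewrite /f; case: ifPn => [|?]; rewrite ?normr_gt0.
have [d [d0 d1 df]] := finite_pos_lower_bound f0.
by exists d; split=> // i j /negPf ij; have := df (i, j); rewrite /f /= ij.
Qed.

Lemma normalize_rows M : nonzero_rows M ->
  exists2 N, unit_rows N & forall i, row i M = nrm (row i M) *: row i N.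
Proof.
move=> M0; have c0 i : nrm (row i M) != 0 by rewrite nrm_eq0.
pose N : 'M[F]_(n, 2) := \matrix_(i, j) ((nrm (row i M))^-1 * M i j).
have rN i : row i N = (nrm (row i M))^-1 *: row i M.
  by apply/rowP => j; rewrite !mxE.
exists N => i; rewrite rN; last by rewrite scalerA mulfV // scale1r.
by rewrite nrmZ normfV (ger0_norm (nrm_ge0 _)) mulVf.
Qed.

Lemma nonzero_rows_mulmx M A :
  A \in unitmx -> nonzero_rows M -> nonzero_rows (M *m A^T).
Proof. by move=> uA M0 i; rewrite row_mul mulmx_neq0. Qed.

Definition length_prod M A : F := \prod_i nrm (row i M *m A^T).

Lemma length_prod_ge0 M A : 0 <= length_prod M A.
Proof. by apply: prodr_ge0 => i _; exact: nrm_ge0. Qed.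

Lemma det1_unitmx A : \det A = 1 -> A \in unitmx.
Proof. by rewrite unitmxE => ->; exact: unitr1. Qed.

(** Let d <= 1 be a lower bound for the nonzero determinants of pairs of rows.
    If all the vectors A v_i have length at least d, the product is at least
    d^n.  Otherwise some A v_i has length x < d; the m < n / 2 rows at the same
    point have the same length, and all the others have length at least
    y = d^2 / x > d, because their determinant with v_i is at least d >= d^2.
    Then x^m y^(n - m) = (x y)^m y^(n - 2 m) >= d^n. *)
Lemma length_prod_lower_bound M : unit_rows M -> no_half (pts M) ->
  exists2 c : F, 0 < c & forall A, \det A = 1 -> c <= length_prod M A.
Proof.
move=> M1 hM; have M0 := unit_rows_nonzero M1.
have [d [d0 d1 dM]] := det_gap M.
exists (d ^+ n); first exact: exprn_gt0.
move=> A A1; pose x i := nrm (row i M *m A^T).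
have xr i : x i \is Num.real by rewrite ger0_real ?nrm_ge0.
have dr : d \is Num.real by rewrite gtr0_real.
(* Either no row is contracted below d, or the row i0 is. *)
have [dx|] := pselect (forall i, d <= x i).
  rewrite -[n in d ^+ n]card_ord -prodr_const.
  by apply: ler_prod => i _; rewrite ltW //= dx.
move=> /existsNP[i0 /negP]; rewrite -real_ltNge // => xd.
have x0 : 0 < x i0.
  by rewrite nrm_gt0 mulmx_neq0 // det1_unitmx.
pose S := [pred j | pts M j == pts M i0].
have xS j : S j -> x j = x i0.
  move=> /eqP /(pt_eqP (M0 j) (M0 i0)) /(det2_eq0P (M0 j) (M0 i0))[c c0 jE].
  have c1 : `|c| = 1 by have := M1 j; rewrite jE nrmZ M1 mulr1.
  by rewrite /x jE -scalemxAl nrmZ c1 mul1r.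
pose y := d ^+ 2 / x i0.
have xNS j : ~~ S j -> y <= x j.
  move=> /negP jS; rewrite ler_pdivrMr // mulrC.
  have ij : det2 (row i0 M) (row j M) != 0.
    by apply/eqP => /(pt_eqP (M0 i0) (M0 j)) e; apply: jS; rewrite /S /= /pts e.
  apply: le_trans (norm_det2_le _ _); rewrite det2_mulmx A1 mul1r.
  by apply: le_trans (dM _ _ ij); rewrite expr2 ler_piMl // ltW.
have yd : d <= y by rewrite ler_pdivlMr // expr2 ler_wpM2l // ltW.
have y0 : 0 < y by exact: lt_le_trans yd.
rewrite /length_prod (bigID S) /=.
have -> : \prod_(j | S j) nrm (row j M *m A^T) = x i0 ^+ #|S|.
  by rewrite -prodr_const; apply: eq_bigr => j /xS.
have lo : y ^+ (n - #|S|) <= \prod_(j | ~~ S j) nrm (row j M *m A^T).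
  have -> : (n - #|S|)%N = #|predC S|.
    by rewrite -[X in (X - _)%N](card_ord n) -(cardC S) addKn.
  rewrite -prodr_const; apply: ler_prod => j jS.
  by rewrite ltW //=; exact: xNS.
apply: le_trans (ler_wpM2l _ lo); last by rewrite exprn_ge0 // ltW.
have m2 : (2 * #|S| < n)%N by exact: hM.
have -> : (n - #|S|)%N = (#|S| + (n - 2 * #|S|))%N.
  by move: #|S| m2 => m m2; lia.
rewrite exprD mulrA -exprMn /y mulrCA divff ?gt_eqF // mulr1 -exprM.
rewrite -[n in leLHS](subnKC (ltnW m2)) exprD.
apply: ler_wpM2l; first exact/exprn_ge0/ltW.
by apply: lerXn2r; rewrite ?nnegrE //; exact: ltW.
Qed.

(** Otherwise f could be halved again and again, against its positive lower
    bound. *)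
Lemma near_minimizer M : (forall x : F, exists k : nat, `|x| < 2 ^+ k) ->
  unit_rows M -> no_half (pts M) ->
  exists2 A, \det A = 1 & forall B, \det B = 1 ->
    length_prod M A <= 2 * length_prod M (B *m A).
Proof.
move=> arch M1 hM; have [c c0 cM] := length_prod_lower_bound M1 hM.
have fr A : length_prod M A \is Num.real by rewrite ger0_real ?length_prod_ge0.
apply: contrapT => noA.
have step k : exists2 A, \det A = 1 &
    2 ^+ k * length_prod M A <= length_prod M 1%:M.
  elim: k => [|k [A A1 IH]]; first by exists 1%:M; rewrite ?det1 // expr0 mul1r.
  have [B [B1 AB]] : exists B, \det B = 1 /\
      2 * length_prod M (B *m A) < length_prod M A.
    apply: contrapT => noB; apply: noA; exists A => // B B1.
    rewrite real_leNgt ?realM ?realn //; apply/negP => AB.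
    by apply: noB; exists B.
  exists (B *m A); first by rewrite det_mulmx A1 B1 mulr1.
  apply: le_trans IH; rewrite exprSr -mulrA ler_wpM2l ?exprn_ge0 //.
  exact: ltW.
have [k hk] := arch (length_prod M 1%:M / c).
have [A A1 hA] := step k.
have lt1 : length_prod M 1%:M < 2 ^+ k * c.
  rewrite -ltr_pdivrMr //; apply: le_lt_trans hk.
  by rewrite ger0_norm // divr_ge0 ?length_prod_ge0 // ltW.
have le1 : 2 ^+ k * c <= length_prod M 1%:M.
  by apply: le_trans hA; rewrite ler_wpM2l ?exprn_ge0 // cM.
by have := lt_le_trans lt1 le1; rewrite ltxx.
Qed.

(** The rows of B are t det(v, .) and t^-1 phi for a linear form phi chosen to
    make the determinant 1.  The first one kills v; the constant C bounds both
    forms on unit vectors and does not depend on t. *)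
Lemma contracting_sl2 (v : 'rV[F]_2) : nrm v = 1 ->
  exists2 C : F, 1 <= C & forall t, 1 <= t -> exists2 B, \det B = 1 &
  forall w, nrm w = 1 -> nrm (w *m B^T) <= C * t /\
    (det2 v w = 0 -> nrm (w *m B^T) <= C / t).
Proof.
move=> v1; have v0 := nrm1_neq0 v1.
have [a [b ab]] : exists a b, - v 0 1 * b - v 0 0 * a = 1.
  have [e|v00] := eqVneq (v 0 0) 0.
    have v01 : v 0 1 != 0.
      by apply: contra_neq v0 => e1; apply: vec2_eqP; rewrite mxE.
    by exists 0, (- (v 0 1)^-1); field.
  by exists (- (v 0 0)^-1), 0; field.
exists (1 + (`|a| + `|b|)); first by rewrite lerDl addr_ge0.
move=> t t1; have t0 : 0 < t by exact: lt_le_trans t1.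
have tr : t^-1 <= t by apply: (le_trans _ t1); rewrite invf_le1.
pose B : 'M[F]_2 := \matrix_(i, j) if i == 0
  then (if j == 0 then - (t * v 0 1) else t * v 0 0)
  else (if j == 0 then t^-1 * a else t^-1 * b).
exists B.
  rewrite det_ord2 !mxE /= -ab; field.
  by rewrite gt_eqF.
move=> w w1.
have -> : nrm (w *m B^T) = t * `|det2 v w| + t^-1 * `|w 0 0 * a + w 0 1 * b|.
  rewrite /nrm !mxE !sum_ord2 !mxE /=.
  have tV0 : 0 < t^-1 by rewrite invr_gt0.
  have eM s z : 0 < s -> s * `|z| = `|s * z| :> F.
    by move=> s0; rewrite normrM gtr0_norm.
  rewrite !eM //; congr (_ + _); congr Num.norm; rewrite /det2; ring.
have phi : `|w 0 0 * a + w 0 1 * b| <= `|a| + `|b|.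
  apply: le_trans (ler_normD _ _) _; rewrite !normrM.
  have := lexx (nrm w); rewrite {1}/nrm w1 => w01.
  apply: lerD; apply: ler_piMl => //; apply: le_trans w01.
    by rewrite lerDl.
  by rewrite lerDr.
have phi0 : 0 <= `|w 0 0 * a + w 0 1 * b| by [].
have dvw : `|det2 v w| <= 1 by have := norm_det2_le v w; rewrite v1 w1 mulr1.
have tV0 : 0 <= t^-1 by rewrite invr_ge0 ltW.
split=> [|->].
  rewrite mulrDl mul1r; apply: lerD; first by rewrite ler_piMr // (ltW t0).
  by rewrite mulrC; apply: ler_pM.
rewrite normr0 mulr0 add0r mulrC; apply: ler_pM => //.
by apply: le_trans phi _; rewrite lerDr.
Qed.

End NormBounds.

Section OddDegree.
Variables (F : numFieldType) (n : nat).
Local Notation P1 := (proj_space F 1).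
Implicit Types (M : 'M[F]_(n, 2)) (A B : 'M[F]_2).

(** As f(1) = 1 for a unit tuple, the condition says that the identity comes
    within a factor 2 of the infimum of f over SL_2. *)
Definition nearly_minimal : set 'M[F]_(n, 2) :=
  [set M | unit_rows M /\ forall B, \det B = 1 -> 1 <= 2 * length_prod M B].

Lemma continuous_nrm (T : topologicalType) (f : T -> 'rV[F]_2) :
  (forall j, continuous (fun t => f t 0 j)) -> continuous (fun t => nrm (f t)).
Proof.
by move=> cf t; apply: cvgD; apply: cvg_norm; exact: cf.
Qed.

Lemma continuous_row_mulmx m (i : 'I_n) (B : 'M[F]_(2, m)) j :
  continuous (fun M => (row i M *m B) 0 j).
Proof.
under eq_fun do rewrite mxE.
apply: continuous_sum_ord => k; apply: continuous_mul.
  by under eq_fun do rewrite mxE; exact: coord_continuous.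
exact: cst_continuous.
Qed.

Lemma closed_unit_rows : closed (@unit_rows F n).
Proof.
rewrite (_ : @unit_rows F n = \bigcap_i [set M | nrm (row i M) = 1]).
  apply: closed_bigI => i _; apply: closed_fiber; apply: continuous_nrm => j.
  by under eq_fun do rewrite mxE; exact: coord_continuous.
by apply/seteqP; split=> [M M1 i _|M M1 i]; [exact: M1 | exact: M1 i I].
Qed.

Lemma compact_unit_rows :
  compact [set x : F | `|x| <= 1] -> compact (@unit_rows F n).
Proof.
move=> Fball.
apply: (subclosed_compact closed_unit_rows (compact_mx Fball)).
move=> M M1 i j /=; rewrite -(M1 i) /nrm !mxE.
by move: j; apply: ord2P; rewrite ?lerDl ?lerDr.
Qed.

Lemma compact_nearly_minimal :
  compact [set x : F | `|x| <= 1] -> compact nearly_minimal.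
Proof.
move=> Fball.
have cN : closed (\bigcap_(B in [set B | \det B = 1])
    [set M : 'M[F]_(n, 2) | `|1 : F| <= `|2 * length_prod M B|]).
  apply: closed_bigI => B _; apply: closed_le_norm; first exact: cst_continuous.
  apply: continuous_mul; first exact: cst_continuous.
  apply: (@continuous_prod _ F _ (index_enum 'I_n)
    (fun i M => nrm (row i M *m B^T))) => i.
  by apply: continuous_nrm => j; exact: continuous_row_mulmx.
have : compact (@unit_rows F n `&` \bigcap_(B in [set B | \det B = 1])
    [set M : 'M[F]_(n, 2) | `|1 : F| <= `|2 * length_prod M B|]).
  apply: (subclosed_compact _ (compact_unit_rows Fball)); last first.
    by apply: subIset; left.
  by apply: closedI; first exact: closed_unit_rows.
congr compact; apply/seteqP; split=> M [M1 hM]; split=> // B B1.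
  have := hM B B1; rewrite /= normr1 ger0_norm //.
  by rewrite mulr_ge0 ?length_prod_ge0.
rewrite /= normr1 ger0_norm ?hM //.
by rewrite mulr_ge0 ?length_prod_ge0.
Qed.

(** If 2 m >= n then 2 m > n by parity, and contracting the heavy point by t
    gives f(B) <= (C / t)^m (C t)^(n - m) <= C^n / t. *)
Lemma nearly_minimal_no_half M : odd n -> nearly_minimal M -> no_half (pts M).
Proof.
move=> nodd [M1 minM] x; rewrite ltnNge; apply/negP => nm.
have M0 := unit_rows_nonzero M1.
have x1 := nrm_unit_coord x; have [C C1 contr] := contracting_sl2 x1.
have C0 : 0 < C by exact: lt_le_trans C1.
(* This t makes 2 C^n / t < 1. *)
pose t := 2 * C ^+ n + 1; have Cn0 : 0 < C ^+ n by rewrite exprn_gt0.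
have t1 : 1 <= t by rewrite lerDr mulr_ge0 // ltW.
have t0 : 0 < t by exact: lt_le_trans t1.
have [B B1 hB] := contr t t1.
pose S := [pred i | pts M i == x]; have {}nm : (n <= 2 * #|S|)%N by exact: nm.
have bound : length_prod M B <= (C / t) ^+ #|S| * (C * t) ^+ #|predC S|.
  rewrite /length_prod (bigID S) /= -!prodr_const.
  apply: ler_pM; try by apply: prodr_ge0 => i _; exact: nrm_ge0.
    apply: ler_prod => i /eqP iS; rewrite nrm_ge0 /=.
    have [_] := hB _ (M1 i); apply; apply/(pt_eqP _ (M0 i)).
      exact: nrm1_neq0 (nrm_unit_coord x).
    by rewrite pt_unit_coord -iS.
  apply: ler_prod => i iS; rewrite nrm_ge0 /=.
  by have [] := hB _ (M1 i).
have cardS : (#|S| + #|predC S| = n)%N by rewrite cardC card_ord.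
move: bound cardS nm; move: #|S| #|predC S| => m k bound mk nm.
have [r mE] : exists r, m = (k + r.+1)%N.
  exists (m - k).-1; move: nodd; rewrite -mk oddD.
  by case: (leqP m k) => ?; lia.
have tV0 : 0 <= t^-1 by rewrite invr_ge0 ltW.
have tV1 : t^-1 <= 1 by rewrite invf_le1.
have rhs : (C / t) ^+ m * (C * t) ^+ k <= C ^+ n / t.
  rewrite !exprMn mulrACA -exprD mk mE [X in _ * (X * _)]exprD mulrAC -exprMn.
  rewrite mulVf ?gt_eqF // expr1n mul1r ler_wpM2l ?(ltW Cn0) //.
  by rewrite exprS ler_piMr // exprn_ile1.
have := le_trans (minM B B1) (ler_wpM2l (ler0n F 2) (le_trans bound rhs)).
rewrite mulrA ler_pdivlMr // mul1r /t -lerBrDl subrr => /le_lt_trans.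
by move=> /(_ _ ltr01); rewrite ltxx.
Qed.

Lemma moduli_hausP (n0 : (0 < n)%N) (q : moduli F n) : moduli_haus F n q <->
  exists p (hp : no_half p), q = orbit_class (no_half_fs n0 hp).
Proof.
split=> [[D /= hD <-]|[p [hp ->]]].
  have [p Dp] := divisorP (set_val D).
  have hp : no_half p by rewrite -max_mult_no_half -Dp.
  exists p, hp; congr (\pi_(moduli F n) _); exact: val_inj.
exists (SigSub (mem_set (no_half_fs n0 hp))) => //=.
by rewrite max_mult_no_half.
Qed.

Lemma unit_rows_of_points (p : 'I_n -> P1) :
  exists2 M, unit_rows M & pts M = p.
Proof.
pose M : 'M[F]_(n, 2) := \matrix_(i, j) unit_coord (p i) 0 j.
have rM i : row i M = unit_coord (p i) by apply/rowP => j; rewrite !mxE.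
exists M => [i|]; first by rewrite rM nrm_unit_coord.
by apply/funext => i; rewrite /pts rM pt_unit_coord.
Qed.

(** Normalizing the rows of M A^T, for A nearly minimizing f, divides f by f(A)
    and translates its argument by A. *)
Lemma nearly_minimal_orbit (p : 'I_n -> P1) :
  (forall x : F, exists k : nat, `|x| < 2 ^+ k) -> no_half p ->
  exists2 N, nearly_minimal N &
    exists g, pgl_act_div g (div_of p) = div_of (pts N).
Proof.
move=> Farch hp; have [M M1 Mp] := unit_rows_of_points p.
have hM : no_half (pts M) by rewrite Mp.
have [A A1 minA] := near_minimizer Farch M1 hM.
have M0 := unit_rows_nonzero M1; have uA := det1_unitmx A1.
have MA0 := nonzero_rows_mulmx uA M0; have [N N1 MAE] := normalize_rows MA0.
have rE i : row i M *m A^T = nrm (row i M *m A^T) *: row i N.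
  by rewrite -row_mul -MAE.
have c0 i : 0 < nrm (row i M *m A^T) by rewrite -row_mul nrm_gt0 MA0.
exists N; last first.
  exists (pgl uA); rewrite pgl_act_div_of -Mp; congr div_of.
  by apply/funext => i /=; rewrite /pts pgl_act_pt // rE pt_scale // gt_eqF.
split=> // B B1.
have A0 : 0 < length_prod M A.
  by apply: prodr_gt0 => i _; exact: c0.
have BA : length_prod M (B *m A) = length_prod M A * length_prod N B.
  rewrite /length_prod -big_split /=; apply: eq_bigr => i _.
  by rewrite trmx_mul mulmxA rE -scalemxAl nrmZ -rE gtr0_norm.
by rewrite -(ler_pM2l A0) mulr1 mulrCA -BA; exact: minA.
Qed.

Lemma compact_moduli_odd :
  compact [set x : F | `|x| <= 1] ->
  (forall x : F, exists k : nat, `|x| < 2 ^+ k) -> (0 < n)%N ->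
  odd n -> compact (moduli_haus F n).
Proof.
move=> Fball Farch n0 nodd; pose K := nearly_minimal.
have K0 : K `<=` @nonzero_rows F n by move=> M [/unit_rows_nonzero].
have Kh M : K M -> no_half (pts M) by exact: nearly_minimal_no_half.
have Kfs M (KM : K M) := no_half_fs n0 (Kh M KM).
have := @compact_orbit_classes F n K K0 Kfs (compact_nearly_minimal Fball).
congr compact; apply/seteqP; split=> [_ [u _ <-]|q].
  apply/(moduli_hausP n0); exists (pts (set_val u)), (Kh _ (set_valP u)).
  by congr (\pi_(moduli F n) _); exact: val_inj.
move=> /(moduli_hausP n0)[p [hp ->]].
have [N KN [g gp]] := nearly_minimal_orbit Farch hp.
exists (SigSub (mem_set KN)) => //; apply/esym/eqquotP/asboolP.
by exists g.
Qed.

End OddDegree.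

(** * Even degree *)

Section EvenDegree.
Variables (F : numFieldType) (k : nat).
Local Notation n := (2 * k)%N.
Local Notation P1 := (proj_space F 1).
Implicit Types (M N : 'M[F]_(n, 2)) (A B : 'M[F]_2) (i j l m : 'I_n).

(** Both sides are homogeneous of the same degree in each row, and both are
    multiplied by the square of det A when A acts: this makes the condition
    depend only on the orbit of the ordered tuple of points. *)
Definition pinched (eta : F) : set 'M[F]_(n, 2) := [set M | forall i j l m,
  (i < k)%N -> (j < k)%N -> (k <= l)%N -> (k <= m)%N ->
  `|det2 (row i M) (row j M) * det2 (row l M) (row m M)| <=
  `|eta * (det2 (row i M) (row l M) * det2 (row j M) (row m M))|].

Lemma pinched_le eta eta' M :
  `|eta| <= `|eta'| -> pinched eta M -> pinched eta' M.
Proof.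
move=> le_eta sM i j l m ik jk kl km.
apply: le_trans (sM i j l m ik jk kl km) _.
by rewrite !normrM ler_wpM2r // mulr_ge0.
Qed.

Lemma pinched_rescale eta M N (c : 'I_n -> F) : (forall i, c i != 0) ->
  (forall i, row i M = c i *: row i N) -> pinched eta M -> pinched eta N.
Proof.
move=> c0 MN sM i j l m ik jk kl km; have := sM i j l m ik jk kl km.
rewrite !MN !det2Zl !det2Zr.
have C0 : 0 < `|c i * c j * (c l * c m)| by rewrite normr_gt0 !mulf_neq0.
rewrite -[in X in _ -> X](ler_pM2l C0) -!normrM.
by congr (_ <= _); congr Num.norm; ring.
Qed.

Lemma pinched_mulmx eta M A :
  \det A != 0 -> pinched eta M -> pinched eta (M *m A^T).
Proof.
move=> A0 sM i j l m ik jk kl km; have := sM i j l m ik jk kl km.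
rewrite !row_mul !det2_mulmx.
have C0 : 0 < `|\det A * \det A| by rewrite normr_gt0 !mulf_neq0.
rewrite -[in X in X -> _](ler_pM2l C0) -!normrM.
by congr (_ <= _); congr Num.norm; ring.
Qed.

Definition unit_pinched eta := @unit_rows F n `&` pinched eta.

Lemma continuous_det2_row i j :
  continuous (fun M => det2 (row i M) (row j M)).
Proof.
have c (i' : 'I_n) (b : 'I_2) : continuous (fun M => row i' M 0 b).
  by under eq_fun do rewrite mxE; exact: coord_continuous.
by apply: continuous_sub; apply: continuous_mul; exact: c.
Qed.

Lemma closed_pinched eta : closed (pinched eta).
Proof.
rewrite (_ : pinched eta =
   \bigcap_(t in [set t : ('I_n * 'I_n) * ('I_n * 'I_n) |
      [/\ (t.1.1 < k)%N, (t.1.2 < k)%N, (k <= t.2.1)%N & (k <= t.2.2)%N]])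
   [set M | `|det2 (row t.1.1 M) (row t.1.2 M) *
              det2 (row t.2.1 M) (row t.2.2 M)|
   <= `|eta * (det2 (row t.1.1 M) (row t.2.1 M) *
               det2 (row t.1.2 M) (row t.2.2 M))|]).
  apply: closed_bigI => t _; apply: closed_le_norm.
    by apply: continuous_mul; exact: continuous_det2_row.
  apply: continuous_mul; first exact: cst_continuous.
  by apply: continuous_mul; exact: continuous_det2_row.
apply/seteqP; split=> M sM.
  by move=> [[i j] [l m]] /= [ik jk kl km]; exact: sM.
by move=> i j l m ik jk kl km; exact: (sM ((i, j), (l, m)) (And4 ik jk kl km)).
Qed.

Lemma compact_unit_pinched eta :
  compact [set x : F | `|x| <= 1] -> compact (unit_pinched eta).
Proof.
move=> Fball; have cc : closed (unit_pinched eta).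
  by apply: closedI; [exact: closed_unit_rows | exact: closed_pinched].
apply: (subclosed_compact cc (compact_unit_rows Fball)).
by move=> M [].
Qed.

(** A representative of an element of PGL_2 need not have determinant 1, but the
    condition is invariant under all invertible matrices. *)
Lemma unit_pinched_saturated eta (D E : @fs_divisor F n) : same_orbit D E ->
  (exists2 M, unit_pinched eta M & set_val D = div_of (pts M)) ->
  exists2 M, unit_pinched eta M & set_val E = div_of (pts M).
Proof.
move=> /asboolP[g gDE] [M [M1 sM] DM].
have uA := pgl_mx_unit g; set A := pgl_mx g in uA.
have A0 : \det A != 0 by move: uA; rewrite unitmxE unitfE.
have M0 := unit_rows_nonzero M1.
have MA0 := nonzero_rows_mulmx uA M0.
have [N N1 MAE] := normalize_rows MA0.
have c0 i : nrm (row i (M *m A^T)) != 0 by rewrite nrm_eq0 MA0.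
exists N; first split=> //.
  exact: pinched_rescale c0 MAE (pinched_mulmx A0 sM).
rewrite -gDE DM pgl_act_div_of; congr div_of; apply/funext => i /=.
rewrite -[g]pgl_mxK /pts (pgl_act_pt (pgl_mx_unit g)) // -row_mul MAE.
by rewrite pt_scale.
Qed.

Definition pinched_classes eta : set (moduli F n) :=
  [set q | exists2 D : @fs_divisor F n, q = \pi_(moduli F n) D &
    exists2 M, unit_pinched eta M & set_val D = div_of (pts M)].

Lemma closed_pinched_classes eta :
  compact [set x : F | `|x| <= 1] -> closed (pinched_classes eta).
Proof.
move=> Fball; apply: closed_orbit_classes.
- by move=> M [/unit_rows_nonzero].
- exact: compact_unit_pinched.
- exact: unit_pinched_saturated.
Qed.

Lemma card_ord_below : #|[pred i : 'I_n | (i < k)%N]| = k.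
Proof.
have kn : (k <= n)%N by lia.
by rewrite -sum1_card (big_ord_narrow kn) sum1_card card_ord.
Qed.

Lemma card_ord_above : #|[pred i : 'I_n | (k <= i)%N]| = k.
Proof.
pose P := [pred i : 'I_n | (i < k)%N].
have cP : (#|P| + #|predC P| = n)%N by rewrite cardC card_ord.
have Pk : #|P| = k by exact: card_ord_below.
have -> : #|[pred i : 'I_n | (k <= i)%N]| = #|predC P|.
  by apply: eq_card => i; rewrite !inE -leqNgt.
by rewrite Pk in cP; lia.
Qed.

Lemma constant_half_not_no_half (P : pred 'I_n) (p : 'I_n -> P1) x :
  #|P| = k -> (forall i, P i -> p i = x) -> ~ no_half p.
Proof.
move=> cP Px /(_ x); apply/negP; rewrite -leqNgt leq_mul2l /= -{1}cP.
apply/subset_leq_card/fintype.subsetP => i iP; by rewrite inE (Px i iP) eqxx.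
Qed.

(** Comparable to the usual distance between points; unlike a determinant of
    rows it depends neither on the ordering nor on the lifts. *)
Definition chord (x y : P1) : F := `|det2 (unit_coord x) (unit_coord y)|.

Lemma chord_unit_rows M i j : unit_rows M ->
  `|det2 (row i M) (row j M)| = chord (pts M i) (pts M j).
Proof.
move=> M1; have M0 := unit_rows_nonzero M1.
have cE l : exists2 c, `|c| = 1 & row l M = c *: unit_coord (pts M l).
  have : pt (row l M) = pt (unit_coord (pts M l)) by rewrite pt_unit_coord.
  move/(pt_eqP (M0 l) (nrm1_neq0 (nrm_unit_coord _))).
  move/(det2_eq0P (M0 l) (nrm1_neq0 (nrm_unit_coord _))) => [c c0 e].
  by exists c => //; have := M1 l; rewrite e nrmZ nrm_unit_coord mulr1.
have [c c1 ->] := cE i; have [d d1 ->] := cE j.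
by rewrite det2Zl det2Zr !normrM c1 d1 !mul1r.
Qed.

Lemma chord_le1 x y : chord x y <= 1.
Proof.
by apply: le_trans (norm_det2_le _ _) _; rewrite !nrm_unit_coord mulr1.
Qed.

Lemma chord_eq0 x y : chord x y = 0 -> x = y.
Proof.
move/eqP; rewrite normr_eq0 => /eqP /pt_eqP.
by rewrite !pt_unit_coord; apply; apply: nrm1_neq0 (nrm_unit_coord _).
Qed.

Lemma chord_gap (p : 'I_n -> P1) : exists d, [/\ 0 < d, d <= 1 &
  forall i j, p i != p j -> d <= chord (p i) (p j)].
Proof.
have [M M1 <-] := unit_rows_of_points p; have [d [d0 d1 dM]] := det_gap M.
exists d; split=> // i j ij; rewrite -chord_unit_rows //; apply: dM.
by rewrite -normr_eq0 chord_unit_rows //; apply: contra_neq ij => /chord_eq0.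
Qed.

(** With d a lower bound for the chords between distinct points, eta < d^2
    forces one of the two pairs in each quadruple to coincide, because chords
    are at most 1.  If two of the first k points differ, the last k all
    coincide. *)
Lemma no_pinched_class (p : 'I_n -> P1) : no_half p ->
  exists2 eta, 0 < eta <= 1 & forall M, unit_pinched eta M ->
    ~ perm_eq (codom p) (codom (pts M)).
Proof.
move=> hp; have [d [d0 d1 dp]] := chord_gap p.
exists (d ^+ 2 / 2).
  rewrite divr_gt0 ?exprn_gt0 //= ler_pdivrMr // mul1r.
  have d2 : d ^+ 2 <= 1 by rewrite exprn_ile1 // ltW.
  by apply: le_trans d2 _; rewrite ler1n.
move=> M [M1 sM] pM.
have hM : no_half (pts M).
  rewrite -max_mult_no_half; have /eq_div_ofP <- := pM.
  by rewrite max_mult_no_half.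
have dM i j : pts M i != pts M j -> d <= chord (pts M i) (pts M j).
  have /codomP[i' ->] : pts M i \in codom p by rewrite (perm_mem pM) codom_f.
  have /codomP[j' ->] : pts M j \in codom p by rewrite (perm_mem pM) codom_f.
  exact: dp.
have eitherP i j l m : (i < k)%N -> (j < k)%N -> (k <= l)%N -> (k <= m)%N ->
    pts M i = pts M j \/ pts M l = pts M m.
  move=> ik jk kl km; have [|ij] := eqVneq (pts M i) (pts M j); first by left.
  have [|lm] := eqVneq (pts M l) (pts M m); first by right.
  have := sM i j l m ik jk kl km.
  rewrite normrM [X in _ <= X]normrM [X in _ <= _ * X]normrM.
  rewrite !chord_unit_rows // => le1.
  have le2 : d * d <= chord (pts M i) (pts M j) * chord (pts M l) (pts M m).
    by apply: ler_pM; rewrite ?(ltW d0) ?dM.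
  have : d * d <= d ^+ 2 / 2.
    apply: le_trans le2 (le_trans le1 _).
    have eta0 : 0 < d ^+ 2 / 2 by rewrite divr_gt0 ?exprn_gt0.
    rewrite (gtr0_norm eta0) ler_piMr //.
      by rewrite divr_ge0 ?exprn_ge0 // ltW.
    by apply: mulr_ile1; rewrite ?chord_le1 // normr_ge0.
  by rewrite ler_pdivlMr // -expr2 ger_pMr ?exprn_gt0 // (ler_nat F 2 1).
have n0 : (0 < n)%N := leq_ltn_trans (leq0n _) (hp (pt 0)).
have kn : (k < n)%N by lia.
have k0 : (0 < k)%N by lia.
have [ij|] := pselect (forall i j, (i < k)%N -> (j < k)%N -> pts M i = pts M j).
  apply: (constant_half_not_no_half (x := pts M (Ordinal n0))
    card_ord_below _ hM).
  by move=> i ik; apply: ij.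
move=> /existsNP[i /existsNP[j /not_implyP[ik /not_implyP[jk ij]]]].
apply: (constant_half_not_no_half (x := pts M (Ordinal kn))
  card_ord_above _ hM).
by move=> l kl; have [//|] := eitherP i j l (Ordinal kn) ik jk kl (leqnn k).
Qed.

(** The first k points are (x_i : 1), near 0, and the others (1 : x_i), near
    infinity, with 0 <= x_i < eta / 2 pairwise distinct. *)
Lemma pinched_example (eta : F) : (3 <= k)%N -> 0 < eta <= 1 ->
  exists2 M, unit_pinched eta M & no_half (pts M).
Proof.
move=> k3 /andP[eta0 eta1].
have n0 : 0 < n%:R :> F by rewrite ltr0n; lia.
pose e := eta / 2; have e0 : 0 < e by rewrite divr_gt0.
have e1 : e <= 2^-1 by rewrite ler_pdivrMr // mulVf ?pnatr_eq0.
(* All determinants within a half are at most e in absolute value, while those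
   across the halves are x_i x_l - 1, of absolute value at least 1 / 2; then
   e^2 = eta^2 / 4 <= eta / 4. *)
pose x i : F := e * (i%:R / n%:R).
have x0 i : 0 <= x i by rewrite mulr_ge0 ?(ltW e0) // divr_ge0 ?(ltW n0).
have xe i : x i <= e.
  rewrite ler_piMr ?(ltW e0) // ler_pdivrMr // mul1r ler_nat ltnW //.
have x_inj i j : x i = x j -> i = j.
  move=> /(mulfI (lt0r_neq0 e0)) /(mulIf (invr_neq0 (lt0r_neq0 n0))) /eqP.
  by rewrite eqr_nat => /eqP /val_inj.
pose v i := if (i < k)%N then vec2 (x i) 1 else vec2 1 (x i).
pose M : 'M[F]_(n, 2) := \matrix_(i, j) v i 0 j.
have rM i : row i M = v i by apply/rowP => j; rewrite !mxE.
have e_le1 : e <= 1 by apply: le_trans e1 _; rewrite invf_le1 ?ler1n.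
have dlow i j : (i < k)%N -> (j < k)%N -> det2 (v i) (v j) = x i - x j.
  by move=> ik jk; rewrite /v ik jk /det2 !mxE /= mulr1 mul1r.
have dhigh i j : (k <= i)%N -> (k <= j)%N -> det2 (v i) (v j) = x j - x i.
  rewrite leqNgt => /negPf ik; rewrite leqNgt => /negPf jk.
  by rewrite /v ik jk /det2 !mxE /= mulr1 mul1r.
have dmix i j : (i < k)%N -> (k <= j)%N -> det2 (v i) (v j) = x i * x j - 1.
  move=> ik; rewrite leqNgt => /negPf jk.
  by rewrite /v ik jk /det2 !mxE /= mulr1.
have xB i j : `|x i - x j| <= e.
  rewrite real_ler_norml ?rpredB ?ger0_real //; apply/andP; split.
    by rewrite -[- e]add0r lerB.
  by rewrite lerBlDr ler_wpDr.
have xM i j : 2^-1 <= `|x i * x j - 1|.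
  have xr : 1 - x i * x j \is Num.real.
    apply: rpredB; first exact: real1.
    by rewrite ger0_real // mulr_ge0.
  rewrite distrC; apply: le_trans (real_ler_norm xr).
  rewrite lerBrDr -lerBrDl; have -> : 1 - 2^-1 = 2^-1 :> F by field.
  apply: le_trans e1; rewrite -[e]mulr1; apply: ler_pM => //.
  exact: le_trans (xe j) e_le1.
have M0 : nonzero_rows M.
  move=> i; rewrite rM /v; apply/eqP; case: ifP => _ /rowP.
    by move=> /(_ 1); rewrite !mxE /=; apply/eqP; rewrite oner_eq0.
  by move=> /(_ 0); rewrite !mxE /=; apply/eqP; rewrite oner_eq0.
have p_inj : injective (pts M).
  move=> i j /(pt_eqP (M0 i) (M0 j)); rewrite !rM.
  have mix0 i' j' : x i' * x j' - 1 <> 0.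
    move=> e'; have := xM i' j'; rewrite e' normr0.
    by rewrite lt_geF // invr_gt0 ltr0n.
  have [ik|ik] := ltnP i k; have [jk|jk] := ltnP j k.
  - by rewrite dlow // => /subr0_eq /x_inj.
  - by rewrite dmix // => /mix0.
  - move=> e'; have : det2 (v j) (v i) = 0.
      by rewrite -[RHS]oppr0 -e' /det2; ring.
    by rewrite dmix // => /mix0.
  - by rewrite dhigh // => /subr0_eq /x_inj.
have [N N1 MN] := normalize_rows M0.
have c0 i : nrm (row i M) != 0 by rewrite nrm_eq0 M0.
have pN : pts N = pts M.
  by apply/funext => i; rewrite /pts MN pt_scale.
exists N; last first.
  rewrite pN => y; have : (#|[pred i | pts M i == y]| <= 1)%N.
    apply/card_le1_eqP => i j; rewrite !inE => /eqP iy /eqP jy.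
    by apply: p_inj; rewrite iy jy.
  by move: #|_| => a; lia.
split=> //; apply: (pinched_rescale c0 MN) => i j l m ik jk kl km.
rewrite !rM dlow // dhigh // !dmix // !normrM (gtr0_norm eta0).
apply: (@le_trans _ _ (e * e)); first by apply: ler_pM.
apply: (@le_trans _ _ (eta * (2^-1 * 2^-1))).
  by rewrite /e mulrACA ler_wpM2r ?mulr_ge0 ?invr_ge0 // ler_piMl // ltW.
by rewrite ler_wpM2l ?(ltW eta0) //; apply: ler_pM; rewrite ?invr_ge0.
Qed.

(** A cluster point of the filter generated by the traces of the pinched classes
    would lie in each of these closed sets. *)
Lemma not_compact_moduli_even :
  compact [set x : F | `|x| <= 1] -> (3 <= k)%N -> ~ compact (moduli_haus F n).
Proof.
move=> Fball k3 cH; have n0 : (0 < n)%N by lia.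
pose B eta := moduli_haus F n `&` pinched_classes eta.
pose G := filter_from [set eta : F | 0 < eta <= 1] B.
have GF : ProperFilter G.
  apply: filter_from_proper; last first.
    move=> eta /(pinched_example k3)[M sM hM].
    exists (orbit_class (no_half_fs n0 hM)); split.
      by apply/(moduli_hausP n0); exists (pts M), hM.
    by exists (SigSub (mem_set (no_half_fs n0 hM))) => //; exists M.
(* The product of two parameters in ]0, 1] is below both. *)
  apply: filter_from_filter; first by exists 1; rewrite /= ltr01 lexx.
  move=> a b /= /andP[a0 a1] /andP[b0 b1]; exists (a * b).
    by rewrite mulr_gt0 //= mulr_ile1 // ltW.
  move=> q [hq [D qD [M [M1 sM] DM]]].
  split; split=> //; exists D => //; exists M => //; split=> //.
    apply: pinched_le sM; rewrite normrM ler_piMr // gtr0_norm //.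
  by apply: pinched_le sM; rewrite normrM ler_piMl // gtr0_norm.
have GH : G (moduli_haus F n).
  by exists 1; rewrite /= ?ltr01 ?lexx // => q [].
have [q [hq clq]] := cH G GF GH.
have [p [hp qE]] := (moduli_hausP n0 q).1 hq.
have [eta eta01 noM] := no_pinched_class hp.
have : pinched_classes eta q.
  apply: (@closed_pinched_classes eta Fball q) => U nU.
  by apply: clq nU; exists eta => // ? [].
move=> [D qD hD]; have DE : same_orbit D (SigSub (mem_set (no_half_fs n0 hp))).
  by move: qD; rewrite qE => /esym/eqquotP.
have [M sM /eq_div_ofP pM] := unit_pinched_saturated DE hD.
exact: noM sM pM.
Qed.

End EvenDegree.

(** * The real and the complex field *)

Section RealAndComplexFields.
Variable R : realType.
Local Notation C := [the numFieldType of R[i]%C].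
Local Open Scope complex_scope.

Lemma real_exp2_bound (x : R) : exists m : nat, `|x| < 2 ^+ m.
Proof.
exists (Num.bound `|x|); apply: lt_trans (archi_boundP (normr_ge0 x)) _.
by rewrite -natrX ltr_nat ltn_expl.
Qed.

Lemma complex_exp2_bound (z : R[i]) : exists m : nat, `|z| < 2 ^+ m.
Proof.
have [m hm] := real_exp2_bound (complex.Re `|z|); exists m.
rewrite -(RRe_real (normr_real z)).
have -> : 2 ^+ m = (2 ^+ m)%:C :> R[i] by rewrite rmorphXn rmorph_nat.
by rewrite ltcR; apply: le_lt_trans hm; rewrite ler_norm.
Qed.

Lemma compact_real_unit_ball : compact [set x : R | `|x| <= 1].
Proof.
have := @segment_compact R (-1) 1; congr compact.
by apply/seteqP; split=> x /=; rewrite in_itv /= ler_norml.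
Qed.

Lemma normcR (x : R) : `|x%:C| = `|x|%:C :> R[i].
Proof. by rewrite normc_def /= expr0n addr0 sqrtr_sqr. Qed.

Lemma continuous_real_complex : continuous (fun x : R => x%:C%C : C).
Proof.
move=> x U /nbhs_ballP[e /= e0 eU]; apply/nbhs_ballP.
have eE : e = (complex.Re e)%:C by rewrite RRe_real // gtr0_real.
exists (complex.Re e); first by move: e0; rewrite /= {1}eE ltcR.
move=> y xy; apply: eU; rewrite /ball /= eE -rmorphB /= normcR ltcR.
exact: xy.
Qed.

Lemma compact_complex_unit_ball : compact [set z : C | `|z| <= 1].
Proof.
pose f (p : R * R) : C := p.1%:C + 'i%C * p.2%:C.
have cf : continuous f.
  move=> p; apply: cvgD.
    apply: (@continuous_comp _ _ _ fst (fun x : R => x%:C%C : C)).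
      exact: cvg_fst.
    exact: continuous_real_complex.
  apply: cvgM; first exact: cvg_cst.
  apply: (@continuous_comp _ _ _ snd (fun x : R => x%:C%C : C)).
    exact: cvg_snd.
  exact: continuous_real_complex.
have cB := compact_real_unit_ball.
have cI := continuous_compact (continuous_subspaceT cf) (compact_setX cB cB).
apply: subclosed_compact cI _.
  have := @closed_le_norm C C id (fun=> 1).
  rewrite normr1; apply; [by move=> ?; exact: cvg_id | exact: cst_continuous].
move=> z /= z1; exists (complex.Re z, complex.Im z); last first.
  by rewrite /f -complexE.
split; rewrite /= -lecR.
  exact: le_trans (normc_ge_Re z) z1.
apply: le_trans z1; rewrite normc_def lecR -sqrtr_sqr.
by rewrite ler_wsqrtr // lerDr sqr_ge0.
Qed.

End RealAndComplexFields.

Local Open Scope complex_scope.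

Theorem theorem3p3 (R : realType) (n : nat) (hn : (5 <= n)%N) :
  ((odd n -> compact (moduli_haus R n)) /\
   (~~ odd n -> ~ compact (moduli_haus R n))) /\
  ((odd n -> compact (moduli_haus R[i] n)) /\
   (~~ odd n -> ~ compact (moduli_haus R[i] n))).
Proof.
have n0 : (0 < n)%N by lia.
have even2 : ~~ odd n -> exists2 k, n = (2 * k)%N & (3 <= k)%N.
  by move=> /negPf n_even; exists n./2; lia.
have RB := @compact_real_unit_ball R; have CB := @compact_complex_unit_ball R.
split; split.
- exact: compact_moduli_odd RB (@real_exp2_bound R) n0.
- by move=> /even2[k -> k3]; exact: not_compact_moduli_even RB k3.
- exact: compact_moduli_odd CB (@complex_exp2_bound R) n0.
- by move=> /even2[k -> k3]; exact: not_compact_moduli_even CB k3.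
Qed.
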